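(* Let $n \ge 2$ and let $M$ be a matching of the hypercube $Q_n$ that spans at most $5$ directions. Then $M$ can be extended to a Hamilton cycle of $Q_n$, i.e. there is a Hamilton cycle of $Q_n$ containing every edge of $M$.
   Context: The $n$-dimensional hypercube $Q_n$ has vertex set $\{0,1\}^n$ (equivalently, all subsets of $\{1,\dots,n\}$), two vertices being adjacent iff they differ in exactly one coordinate. The direction of an edge $uv$ is the coordinate $i\in\{1,\dots,n\}$ in which $u$ and $v$ differ. A matching spans at most $d$ directions if its edges lie in at most $d$ distinct directions. *)

(* Defs.v *)
From mathcomp Require Import all_boot.
Set Implicit Arguments.
Unset Strict Implicit.
Unset Printing Implicit Defensive.

(* A finite simple graph is an (irreflexive, symmetric) relation [e] on a
   finite type [T]; its edges are the unordered pairs [[set u; v]]. *)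
Section Graph.

Variables (T : finType) (e : rel T).

Definition edges : {set {set T}} := [set [set p.1; p.2] | p : T * T & e p.1 p.2].

Definition matching (M : {set {set T}}) : bool := (M \subset edges) && trivIset M.

Definition hamilton_cycle (c : seq T) : bool :=
  [&& 2 < size c, ucycleb e c & [forall v : T, v \in c]].

Definition cycle_edges (c : seq T) : {set {set T}} :=
  [set [set v; next c v] | v in c].

End Graph.

Notation hypercube n := {ffun 'I_n -> bool}.

Definition differ n (u v : hypercube n) : {set 'I_n} := [set i | u i != v i].

Definition hypercube_adj n : rel (hypercube n) := fun u v => #|differ u v| == 1.

Definition directions n (M : {set {set hypercube n}}) : {set 'I_n} :=
  [set i | [exists u, exists v, ([set u; v] \in M) && (differ u v == [set i])]].

(* Main.v *)
Require Import Defs.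
From mathcomp Require Import all_boot zify.

(** A matching whose directions all lie among the first five coordinates is first
    extended to one whose free vertices are pairwise non-adjacent inside every copy of
    [Q_5].  A matching is handled as an involution [p], more generally with edges of the
    complete graph, and a Hamilton cycle through it is a cyclic list of entry points
    linked by cube edges.  Perfect matchings are extended as in Fink's proof of Kreweras'
    conjecture: split the cube along a direction, solve one half after pairing its
    crossing vertices arbitrarily, and contract the resulting paths to matching edges of
    the other half.  With free vertices, the same step (also sending a free vertex
    across, which leaves a dead vertex behind) reduces dimensions 3, 4 and 5 to finite
    checks.  These give, in [Q_5] with at least one free vertex, a free vertex [u] of each
    parity that is joined to every vertex of the opposite parity by a Hamilton path
    through the matching.  For larger [n] such paths in the copies of [Q_5] are chained
    along a Hamilton cycle of the quotient cube [Q_(n-5)]; a copy with such a vertex [u]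
    closes the chain. *)

(** Contracting a path leaves a pair of vertices at arbitrary distance, so the induction must admit
    matching edges of the complete graph. Such pairs may join vertices of equal parity, and free
    vertices then cannot be placed at will: counting the cube edges of the cycle by their even and
    by their odd ends gives a necessary balance between the free and dead vertices of the two
    parities. A splitting is therefore of use only when both halves are balanced; sending a free
    vertex across shifts one unit of imbalance from one half to the other, at the price of a dead
    vertex. A splitting that does not solve a given matching restricts its pairs severely, and these
    restrictions make the exhaustive checks feasible. Paths with a wide choice of ends are needed
    because a copy of [Q_5] has to be entered right next to the vertex where the preceding copy was
    left. Each copy is left at the parity opposite to that of its entry, and [Q_(n-5)] has an even
    number of vertices, so the closing copy is met at a vertex that its [u] can reach. *)

Set Implicit Arguments.
Unset Strict Implicit.
Unset Printing Implicit Defensive.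

(** * Tours through a matching *)

Section Tours.

Variables (T : eqType) (e : rel T).
Hypothesis e_sym : symmetric e.
Implicit Types (p q : T -> T) (A B X U V s : seq T).

(* A cycle through the matching given by the involution [p], whose fixed points are the
   free vertices, is encoded by its entries: entering at [x], it visits [frag p x] and
   leaves from [p x]. *)
Definition frag p x := if p x == x then [:: x] else [:: x; p x].
Definition tour p s := flatten (map (frag p) s).
Definition lk p : rel T := fun x y => e (p x) y.
Definition Sol A p := exists2 s, perm_eq (tour p s) A & cycle (lk p) s.
Definition HP A p a b :=
  exists2 s, perm_eq (tour p (a :: s)) A & path (lk p) a s /\ p (last a s) = b.
Definition invol p A := {in A, forall x, p x \in A /\ p (p x) = x}.
(** The pairs of [p] need not be edges of [e]; only the links between fragments are. *)
Definition Solv A U :=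
  forall p, invol p A -> {in A, forall x, (p x == x) = (x \in U)} -> Sol A p.

Lemma tour_cons p x s : tour p (x :: s) = frag p x ++ tour p s.
Proof. by []. Qed.

Lemma tour_cat p s1 s2 : tour p (s1 ++ s2) = tour p s1 ++ tour p s2.
Proof. by rewrite /tour map_cat flatten_cat. Qed.

Lemma mem_frag p x y : (y \in frag p x) = (y == x) || (y == p x).
Proof.
by rewrite /frag; case: eqP => [->|_]; rewrite !inE ?orbb.
Qed.

Lemma mem_tour p s y : (y \in tour p s) = has (fun x => (y == x) || (y == p x)) s.
Proof. by elim: s => // x s IHs; rewrite tour_cons mem_cat mem_frag IHs. Qed.

Lemma entry_tour p s x : x \in s -> x \in tour p s.
Proof. by move=> xs; rewrite mem_tour; apply/hasP; exists x; rewrite ?eqxx. Qed.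

Lemma perm_tour p s1 s2 : perm_eq s1 s2 -> perm_eq (tour p s1) (tour p s2).
Proof. by move=> s12; apply/perm_flatten/perm_map. Qed.

Lemma eq_in_tour p q s : {in s, p =1 q} -> tour p s = tour q s.
Proof.
by move=> pq; congr flatten; apply/eq_in_map => x xs; rewrite /frag pq.
Qed.

Lemma frag_inv p x : p (p x) = x -> perm_eq (frag p (p x)) (frag p x).
Proof.
move=> px; rewrite /frag px eq_sym; case: eqP => [->//|_].
by rewrite (perm_catC [:: p x] [:: x]).
Qed.

(** Run backwards, a tour enters each fragment at its former exit, so the new entries are the
    partners of the old ones in reverse order. *)
Lemma tour_rev_map p s :
  {in s, forall x, p (p x) = x} -> perm_eq (tour p (rev (map p s))) (tour p s).
Proof.
move=> ps; rewrite (perm_trans (perm_tour p (permEl (perm_rev _)))) //.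
elim: s ps => // x s IHs ps /=; rewrite !tour_cons perm_cat ?IHs //.
  by rewrite frag_inv // ps ?mem_head.
by move=> y ys; rewrite ps // inE ys orbT.
Qed.

Lemma lk_path_rev p x y s : p (p y) = y -> {in s, forall z, p (p z) = z} ->
  path (lk p) x (rcons s y) -> path (lk p) (p y) (rcons (rev (map p s)) (p x)).
Proof.
move=> py; elim: s x => [|z s IHs] x ps /=.
  by rewrite !andbT /lk py e_sym.
case/andP=> xz zs; rewrite rev_cons rcons_path last_rcons IHs //.
  by rewrite /lk ps ?mem_head // e_sym.
by move=> w ws; rewrite ps // inE ws orbT.
Qed.

Lemma lk_path_ext p q x y s w : q y = p x -> {in s, q =1 p} ->
  path (lk q) y (rcons s w) = path (lk p) x (rcons s w).
Proof.
move=> qy; elim: s x y qy => [|z s IHs] x y qy qs /=; first by rewrite /lk qy.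
rewrite {1}/lk qy; congr (_ && _); apply: IHs; first by rewrite qs ?mem_head.
by move=> v vs; rewrite qs // inE vs orbT.
Qed.

Lemma Sol_perm A B p : perm_eq A B -> Sol A p -> Sol B p.
Proof. by move=> AB [s sA cs]; exists s => //; apply: perm_trans AB. Qed.

Lemma Solv_perm A B U : perm_eq A B -> Solv A U -> Solv B U.
Proof.
move=> AB sA p pB pU; apply: (Sol_perm AB); apply: sA => [x xA|x xA].
  by have [|? ?] := pB x; rewrite ?(perm_mem AB) // -(perm_mem AB).
by apply: pU; rewrite -(perm_mem AB).
Qed.

Lemma eq_Solv A U V : {in A, U =i V} -> Solv A U -> Solv A V.
Proof. by move=> UV sA p pA pV; apply: sA => // x xA; rewrite UV ?pV. Qed.

Lemma eq_Sol A p q : {in A, p =1 q} -> Sol A p -> Sol A q.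
Proof.
move=> pq [s sA cs]; have sub x : x \in s -> x \in A.
  by move=> xs; rewrite -(perm_mem sA) entry_tour.
exists s; first by rewrite -(eq_in_tour (p := p)) // => x /sub/pq.
case: s cs sub {sA} => // x s cs sub; rewrite /= (lk_path_ext (p := p) (x := x)) //.
  by rewrite pq ?sub ?mem_head.
by move=> y ys; rewrite pq ?sub // inE ys orbT.
Qed.

(** If the given cycle leaves a fragment from [a] instead of entering it there, it is run
    backwards. *)
Lemma Sol_open A p a : invol p A -> Sol A p -> a \in A ->
  exists2 s, perm_eq (tour p (a :: s)) A & path (lk p) a (rcons s a).
Proof.
move=> pA [s sA cs] aA.
have: a \in tour p s by rewrite (perm_mem sA).
rewrite mem_tour => /hasP[z zs az]; have [i s1 rs] := rot_to zs.
have s1A : perm_eq (tour p (z :: s1)) A.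
  by rewrite -rs; apply: perm_trans sA; apply: perm_tour; rewrite perm_rot.
have cs1 : path (lk p) z (rcons s1 z) by rewrite -(rot_cycle i) rs in cs.
have pp y : y \in z :: s1 -> p (p y) = y.
  by move=> ys; case: (pA y) => //; rewrite -(perm_mem s1A) entry_tour.
have pp1 : {in s1, forall y, p (p y) = y}.
  by move=> y ys; rewrite pp // inE ys orbT.
case/orP: az => /eqP->; first by exists s1.
exists (rev (map p s1)).
  apply: perm_trans s1A; rewrite !tour_cons perm_cat ?tour_rev_map //.
  by rewrite frag_inv // pp ?mem_head.
by apply: lk_path_rev => //; rewrite pp ?mem_head.
Qed.

(** Contraction of a path that runs from [p y] to [y], on through some fragments to [z], and ends in
    [p z]: its two ends become a pair. A free [y] or [z] is itself the end. *)
Definition joinp p y z x := if x == p y then p z else if x == p z then p y else p x.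

Lemma invol_closed A B C p : invol p A -> uniq A -> perm_eq A (C ++ B) ->
  {in C, forall x, p x \in C} -> {in B, forall x, p x \in B}.
Proof.
move=> pA uA AE pC x xB; have xA : x \in A by rewrite (perm_mem AE) mem_cat xB orbT.
have [pxA ppx] := pA x xA; move: pxA; rewrite (perm_mem AE) mem_cat.
case/orP=> // /pC; rewrite ppx => xC; move: uA; rewrite (perm_uniq AE) cat_uniq.
by case/and3P=> _ /hasPn/(_ x xB); rewrite /= xC.
Qed.

Lemma frag_closed p x : p (p x) = x -> {in frag p x, forall y, p y \in frag p x}.
Proof. by move=> px y; rewrite !mem_frag => /orP[]/eqP->; rewrite ?px eqxx ?orbT. Qed.

Lemma tour_closed p s : {in s, forall x, p (p x) = x} ->
  {in tour p s, forall y, p y \in tour p s}.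
Proof.
move=> ps y; rewrite !mem_tour => /hasP[x xs yx]; apply/hasP; exists x => //.
by case/orP: yx => /eqP->; rewrite ?(ps x xs) eqxx ?orbT.
Qed.

Section Join.

Variables (A B s : seq T) (p : T -> T) (y z : T).
Hypotheses (pA : invol p A) (uA : uniq A).
Hypothesis AE : perm_eq A ((frag p y ++ frag p z ++ tour p s) ++ B).

Lemma join_mem : [/\ y \in A, z \in A & {subset s <= A}].
Proof.
split=> [||x xs]; rewrite (perm_mem AE) !mem_cat ?mem_frag ?eqxx ?orbT //.
by rewrite (entry_tour p xs) !orbT.
Qed.

Lemma join_ppA x : x \in A -> p (p x) = x. Proof. by case/pA. Qed.

Lemma join_ppy : p (p y) = y. Proof. by have [yA _ _] := join_mem; apply: join_ppA. Qed.
Lemma join_ppz : p (p z) = z. Proof. by have [_ zA _] := join_mem; apply: join_ppA. Qed.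
Lemma join_pps : {in s, forall x, p (p x) = x}.
Proof. by have [_ _ sA] := join_mem => x /sA/join_ppA. Qed.

Lemma join_closed : {in B, forall x, p x \in B}.
Proof.
apply: (invol_closed pA uA AE) => x; rewrite !mem_cat.
case/or3P=> [/(frag_closed join_ppy)->//|/(frag_closed join_ppz)->|].
  by rewrite orbT.
by move/(tour_closed join_pps)->; rewrite !orbT.
Qed.

Lemma join_uniq : uniq ((frag p y ++ frag p z ++ tour p s) ++ B).
Proof. by rewrite -(perm_uniq AE). Qed.

Lemma join_fragyz x : x \in frag p y -> x \in frag p z -> False.
Proof.
move=> xy xz; move: join_uniq; rewrite -!catA cat_uniq => /and3P[_ /hasPn/(_ x) + _].
by rewrite mem_cat xz => /(_ isT); rewrite /= xy.
Qed.

Lemma join_neq : p y != p z.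
Proof.
apply/eqP=> pyz; apply: (@join_fragyz (p y)); first by rewrite mem_frag eqxx orbT.
by rewrite pyz mem_frag eqxx orbT.
Qed.

Lemma join_notB x : x \in frag p y ++ frag p z -> x \notin B.
Proof.
move=> xyz; move: join_uniq; rewrite cat_uniq => /and3P[_ /hasPn nB _].
by apply/negP => /nB; rewrite catA mem_cat xyz.
Qed.

Lemma join_eqB : {in B, joinp p y z =1 p}.
Proof.
move=> x xB; rewrite /joinp; case: eqP => [xy|_].
  by have := @join_notB x; rewrite mem_cat mem_frag xy eqxx orbT -xy xB => /(_ isT).
case: eqP => // xz.
by have := @join_notB x; rewrite mem_cat !mem_frag xz eqxx !orbT -xz xB => /(_ isT).
Qed.

Lemma invol_join : invol (joinp p y z) (p y :: p z :: B).
Proof.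
have nzy : (p z == p y) = false by rewrite eq_sym (negbTE join_neq).
move=> x; rewrite !inE => /or3P[/eqP->|/eqP->|xB].
- by rewrite /joinp !(eqxx, nzy, orbT).
- by rewrite /joinp !(eqxx, nzy, orbT).
- by rewrite !join_eqB ?join_closed // !orbT; split=> //; apply: join_ppA;
    rewrite (perm_mem AE) mem_cat xB orbT.
Qed.

Lemma uniq_join : uniq (p y :: p z :: B).
Proof.
have [_ _ uB] : [/\ true, true & uniq B].
  by split=> //; move: join_uniq; rewrite cat_uniq => /and3P[].
rewrite /= inE negb_or join_neq uB !join_notB // mem_cat !mem_frag eqxx ?orbT //.
Qed.

(** Removing the new pair from the contracted cycle leaves a path over [B] from [p y] to [p z].
    Nothing is asked of the contracted stretch itself, so [HP_join] can apply this to a virtual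
    one. *)
Lemma join_open : Sol (p y :: p z :: B) (joinp p y z) ->
  exists2 s2, perm_eq (tour p s2) B & path (lk p) y (rcons s2 (p z)).
Proof.
move=> sol; have nyz := join_neq.
have zA' : p z \in p y :: p z :: B by rewrite !inE eqxx orbT.
have [s2 s2B cs2] := Sol_open invol_join sol zA'.
have qz : joinp p y z (p z) = p y by rewrite /joinp eq_sym (negbTE nyz) eqxx.
have {}s2B : perm_eq (tour (joinp p y z) s2) B.
  move: s2B; rewrite tour_cons /frag qz (negbTE nyz).
  have zy : perm_eq [:: p z; p y] [:: p y; p z].
    by rewrite (perm_catC [:: p z] [:: p y]).
  by rewrite (permPl (perm_cat zy (perm_refl _))) !perm_cons.
have q2 : {in s2, joinp p y z =1 p}.
  by move=> x /(entry_tour (joinp p y z)); rewrite (perm_mem s2B) => /join_eqB.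
exists s2; first by rewrite -(eq_in_tour q2).
by rewrite -(lk_path_ext (y := p z) (q := joinp p y z)).
Qed.

Lemma Sol_join :
  path (lk p) (p y) (rcons s z) -> Sol (p y :: p z :: B) (joinp p y z) -> Sol A p.
Proof.
move=> ps /join_open[s2 s2B py].
have := lk_path_rev join_ppz join_pps ps; rewrite join_ppy => pz.
(* The cycle enters at [y], leaves from [p y] into [B], comes back at [p z] and returns to [y] along
   the contracted stretch reversed. *)
exists (y :: s2 ++ p z :: rev (map p s)); last first.
  by rewrite /= rcons_cat /= -cat_rcons cat_path py last_rcons.
rewrite (permPr AE) tour_cons tour_cat tour_cons -!catA perm_cat2l.
rewrite perm_catC [X in perm_eq _ X]catA perm_cat //.
by rewrite perm_cat ?frag_inv ?join_ppz ?tour_rev_map //; apply: join_pps.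
Qed.

End Join.

Lemma even_free X p : uniq X -> invol p X -> {in X, forall x, p x != x} ->
  ~~ odd (size X).
Proof.
have [k] := ubnP (size X); elim: k X => // k IHk [|a X] //= sX /andP[aX uX] pX nX.
have [paX ppa] := pX a (mem_head _ _).
have {}paX : p a \in X.
  by move: paX; rewrite inE (negbTE (nX a _)) // mem_head.
have pr := perm_to_rem paX; rewrite (perm_size pr) /= negbK.
have Xa x : x \in rem (p a) X -> [/\ x \in X, x != a & x != p a].
  rewrite mem_rem_uniq // !inE => /andP[-> xX]; split=> //.
  by apply: contraNneq aX => <-.
apply: IHk; rewrite ?rem_uniq //.
- by rewrite size_rem // prednK; [apply: ltnW | case: (X) paX].
- move=> x /Xa[xX xa xpa]; have [|pxX ppx] := pX x; first by rewrite inE xX orbT.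
  split=> //; rewrite mem_rem_uniq // !inE; apply/andP; split.
    by apply: contraNneq xa => /(congr1 p); rewrite ppx ppa => ->.
  move: pxX; rewrite inE => /orP[/eqP pxa|//].
  by rewrite -ppx pxa eqxx in xpa.
- by move=> x /Xa[xX _ _]; apply: nX; rewrite inE xX orbT.
Qed.

Lemma pairing X : uniq X -> ~~ odd (size X) ->
  exists q, {in X, forall x, [/\ q x \in X, q (q x) = x & q x != x]}.
Proof.
have [k] := ubnP (size X); elim: k X => // k IHk [|a [|b X]] //=.
  by exists id.
move=> sX; rewrite inE negb_or => /and3P[/andP[ab aX] bX uX]; rewrite negbK => eX.
have [|q qX] := IHk X _ uX eX; first by apply: ltnW.
have nX x : x \in X -> (x == a = false) * (x == b = false).
  move=> xX; split; first by apply: contraNF aX => /eqP<-.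
  by apply: contraNF bX => /eqP<-.
exists (fun x => if x == a then b else if x == b then a else q x) => x.
have ba : (b == a) = false by rewrite eq_sym (negbTE ab).
rewrite !inE => /or3P[/eqP->|/eqP->|xX].
- by rewrite !(eqxx, ba, orbT).
- by rewrite !(eqxx, ba, orbT) (negbTE ab).
- by have [qxX qqx nqx] := qX x xX; rewrite !nX // qxX qqx !orbT.
Qed.

Lemma eq_invol A B p : perm_eq A B -> invol p A -> invol p B.
Proof. by move=> AB pA x; rewrite -!(perm_mem AB); apply: pA. Qed.

(** * Absorbing the paths of one half into the matching of the other *)

Section Split.

Variable A1 : seq T.

(** Since [y] and [z] are matched into [A1], both ends of the contracted path lie in [A1]: a stretch
    of the other half turns into a pair inside [A1], whose free vertices stay the same. *)
Lemma absorb R R' s y z p : uniq (R ++ A1) -> invol p (R ++ A1) ->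
    p y \in A1 -> p z \in A1 -> perm_eq R (y :: z :: tour p s ++ R') ->
    path (lk p) (p y) (rcons s z) ->
  [/\ invol (joinp p y z) (R' ++ A1),
      {in A1, forall w, (joinp p y z w == w) = (p w == w)},
      {in R', joinp p y z =1 p}
    & Sol (R' ++ A1) (joinp p y z) -> Sol (R ++ A1) p].
Proof.
move=> uR pR pyA pzA RE pth.
have nA w : w \in R -> w \notin A1.
  move=> wR; move: uR; rewrite cat_uniq => /and3P[_ /hasPn nR _].
  by apply/negP => /nR; rewrite /= wR.
have pp w : w \in R -> p (p w) = w by move=> wR; case: (pR w) => //; rewrite mem_cat wR.
have uA1 : uniq A1 by move: uR; rewrite cat_uniq => /and3P[].
have yR : y \in R by rewrite (perm_mem RE) mem_head.
have zR : z \in R by rewrite (perm_mem RE) !inE eqxx orbT.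
have uR1 : uniq R by move: uR; rewrite cat_uniq => /and3P[].
have yz : y != z.
  by move: uR1; rewrite (perm_uniq RE) /= inE negb_or => /andP[/andP[]].
have pyz : p y != p z.
  by apply: contraNneq yz => pyz; rewrite -(pp y) // pyz pp.
have fr w : w \in R -> p w \in A1 -> frag p w = [:: w; p w].
  move=> wR pwA; rewrite /frag; case: eqP => // pw.
  by have := nA w wR; rewrite -pw pwA.
pose B1 := rem (p z) (rem (p y) A1).
have A1E : perm_eq A1 (p y :: p z :: B1).
  rewrite (permPl (perm_to_rem pyA)) perm_cons; apply: perm_to_rem.
  by rewrite mem_rem_uniq // inE pzA andbT eq_sym.
have AE : perm_eq (R ++ A1) ((frag p y ++ frag p z ++ tour p s) ++ (R' ++ B1)).
  apply/permP => P; have := permP RE P; have := permP A1E P.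
  rewrite !fr //= ?count_cat /= ?count_cat /=; clear; lia.
have A'E : perm_eq (p y :: p z :: R' ++ B1) (R' ++ A1).
  by apply/permP => P; have := permP A1E P; rewrite /= !count_cat /=; clear; lia.
split.
- exact: eq_invol A'E (invol_join pR uR AE).
- move=> w wA; rewrite /joinp; have [->|_] := eqVneq w (p y).
    rewrite pp // eq_sym (negbTE pyz); symmetry; apply: contraTF pyA => /eqP <-.
    exact: nA.
  have [->|//] := eqVneq w (p z); rewrite pp // (negbTE pyz); symmetry.
  by apply: contraTF pzA => /eqP <-; apply: nA.
- by move=> w wR'; apply: (join_eqB uR AE); rewrite mem_cat wR'.
- rewrite perm_sym in A'E; move/(Sol_perm A'E) => sol.
  exact: (Sol_join pR uR AE pth sol).
Qed.

Variables (q : T -> T) (a : T) (F : pred T).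
Hypothesis solA1 : forall p, invol p A1 -> {in A1, forall x, (p x == x) = F x} ->
  Sol A1 p.

(* The part of the first tour still to be absorbed leaves [y] and ends in [a];
   [s1] is its initial segment free of crossing vertices. *)
Lemma Sol_absorb s s1 y p :
    uniq ((y :: a :: tour q (s1 ++ s)) ++ A1) ->
    invol p ((y :: a :: tour q (s1 ++ s)) ++ A1) ->
    p y \in A1 -> p a \in A1 -> q (q y) = y -> {in s1, q =1 p} ->
    {in s, forall x, q (q x) = x} ->
    {in s, forall x, if p x \in A1 then (q x != x) && (p (q x) \in A1) else q x == p x} ->
    {in A1, forall x, (p x == x) = F x} ->
    path (lk q) (q y) (rcons (s1 ++ s) a) ->
  Sol ((y :: a :: tour q (s1 ++ s)) ++ A1) p.
Proof.
elim: s s1 y p => [|x s IHs] s1 y p uR pR pyA paA qqy qp1 qqs qps pF pth.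
  rewrite cats0 in uR pR pth *.
  have RE : perm_eq (y :: a :: tour q s1) (y :: a :: tour p s1 ++ [::]).
    by rewrite cats0 (eq_in_tour qp1).
  have ppy : p (p y) = y by case: (pR y); rewrite //= mem_head.
  rewrite (lk_path_ext (p := p) (x := p y)) ?ppy // in pth.
  have [jI jF _] := absorb uR pR pyA paA RE pth.
  by apply; apply: solA1 => // w wA; rewrite jF ?pF.
have ppy : p (p y) = y by case: (pR y); rewrite //= mem_head.
have := qps x (mem_head _ _); have qqx := qqs x (mem_head _ _).
have sub w : w \in s -> w \in x :: s by rewrite inE => ->; rewrite orbT.
case: ifP => pxA.
  case/andP=> nqx pqxA.
  move: pth; rewrite rcons_cat /= -cat_rcons cat_path last_rcons => /andP[pth1 pth2].
  rewrite (lk_path_ext (p := p) (x := p y)) ?ppy // in pth1.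
  set R := y :: a :: _ in uR pR *.
  have RE : perm_eq R (y :: x :: tour p s1 ++ (q x :: a :: tour q ([::] ++ s))).
    apply/permP => P; rewrite /R tour_cat tour_cons /frag (negbTE nqx) (eq_in_tour qp1).
    by rewrite /= ?count_cat /= ?count_cat /= ?count_cat; clear; lia.
  have [jI jF jR] := absorb uR pR pyA pxA RE pth1; apply; apply: IHs => //.
  - have PE : perm_eq (R ++ A1)
      ((y :: x :: tour p s1) ++ ((q x :: a :: tour q ([::] ++ s)) ++ A1)).
      by rewrite (permPl (perm_cat RE (perm_refl _))) /= -!catA.
    by move: uR; rewrite (perm_uniq PE) cat_uniq => /and3P[].
  - by rewrite jR ?mem_head.
  - by rewrite jR // !inE eqxx orbT.
  - by rewrite qqx.
  - by move=> w /sub/qqs.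
  - move=> w ws; have wR : w \in tour q s by apply: entry_tour.
    have qwR : q w \in tour q s.
      by rewrite mem_tour; apply/hasP; exists w; rewrite ?eqxx ?orbT.
    by have := qps w (sub w ws); rewrite !jR // !inE ?wR ?qwR ?orbT.
  - by move=> w wA; rewrite jF ?pF.
  - by rewrite qqx.
move/eqP=> qx; rewrite -cat_rcons in uR pR pth *; apply: IHs => // [w|w /sub/qqs//|w /sub/qps//].
by rewrite mem_rcons inE => /orP[/eqP->//|/qp1].
Qed.

(** [q] keeps the pairs of [p] inside [A0] and pairs up the vertices that [p] matches into [A1].
    Dropping these artificial pairs cuts a cycle for [q] into paths whose ends all cross; they are
    contracted one by one, and the crossing vertex [a] fixes where the cycle is first cut. *)
Lemma Sol_split A0 p : uniq (A0 ++ A1) -> invol p (A0 ++ A1) -> invol q A0 -> Sol A0 q ->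
    {in A0, forall x, if p x \in A1 then (q x != x) && (p (q x) \in A1) else q x == p x} ->
    a \in A0 -> p a \in A1 -> {in A1, forall x, (p x == x) = F x} ->
  Sol (A0 ++ A1) p.
Proof.
move=> uA pA qA sol qp aA paA pF; have [s sA cs] := Sol_open qA sol aA.
have [qaA qqa] := qA a aA.
have /andP[nqa pqa] : (q a != a) && (p (q a) \in A1) by have := qp a aA; rewrite paA.
have sub w : w \in s -> w \in A0.
  by move=> ws; rewrite -(perm_mem sA) entry_tour // inE ws orbT.
have AE : perm_eq ((q a :: a :: tour q ([::] ++ s)) ++ A1) (A0 ++ A1).
  rewrite perm_cat2r -(permPr sA) tour_cons /frag (negbTE nqa) -cat1s.
  by rewrite -[a :: _ :: _]/([:: a] ++ _) /= (perm_catCA [:: q a] [:: a]).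
apply: (Sol_perm AE); apply: Sol_absorb => //.
- by rewrite (perm_uniq AE).
- by apply: eq_invol pA; rewrite perm_sym.
- by rewrite qqa.
- by move=> w /sub/qA[].
- by move=> w /sub/qp.
- by rewrite qqa.
Qed.

End Split.

(* Fink's induction step: pair the vertices of [A0] matched into [A1] arbitrarily,
   solve [A0], contract the resulting paths into matching edges of [A1]. *)
Lemma Solv_split A0 A1 U p a : uniq (A0 ++ A1) -> invol p (A0 ++ A1) ->
    {in A0 ++ A1, forall x, (p x == x) = (x \in U)} -> Solv A0 U -> Solv A1 U ->
    ~~ odd (count (fun x => x \notin U) A0) -> a \in A0 -> p a \in A1 ->
  Sol (A0 ++ A1) p.
Proof.
move=> uA pA pU s0 s1 ev aA paA.
have uA0 : uniq A0 by move: uA; rewrite cat_uniq => /and3P[].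
have nA x : x \in A0 -> x \in A1 -> False.
  by move: uA; rewrite cat_uniq => /and3P[_ /hasPn nA _] xA0 /nA; rewrite /= xA0.
have pA0 x : x \in A0 -> p x \notin A1 -> p x \in A0.
  by move=> xA npx; have [|] := pA x; rewrite !mem_cat ?xA // (negbTE npx) orbF.
have pp x : x \in A0 -> p (p x) = x by move=> xA; case: (pA x); rewrite // mem_cat xA.
have pU0 x : x \in A0 -> (p x == x) = (x \in U) by move=> xA; rewrite pU // mem_cat xA.
pose X := [seq x <- A0 | p x \in A1].
pose Y := [seq x <- A0 | (p x \notin A1) && (x \notin U)].
have evY : ~~ odd (size Y).
  apply: (@even_free _ p); rewrite ?filter_uniq // => x; rewrite mem_filter.
    case/andP=> /andP[npx nxU] xA; rewrite !mem_filter pp // pA0 //.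
    split=> //; rewrite !andbT -pU0 ?pA0 // pp // eq_sym pU0 // nxU andbT.
    by apply/negP=> /(nA x xA).
  by case/andP=> /andP[npx nxU] xA; rewrite pU0.
(* The matched vertices of [A0] are even in number and those matched inside [A0] come in pairs, so
   the crossing ones are even in number too. *)
have evX : ~~ odd (size X).
  pose c1 x := p x \in A1; pose c2 x := (p x \notin A1) && (x \notin U).
  have c12 : count (predI c1 c2) A0 = 0.
    by rewrite (eq_count (a2 := pred0)) ?count_pred0 // => x /=; rewrite /c1 /c2; case: (_ \in _).
  have cU : count (predU c1 c2) A0 = count (fun x => x \notin U) A0.
    apply: eq_in_count => x xA; rewrite /c1 /c2 /= -pU0 //.
    case: (boolP (p x \in A1)) => //= pxA; apply/esym/eqP=> pxx.
    by apply: (nA x xA); rewrite -pxx.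
  move: evY ev; rewrite -cU -[count _ _]addn0 -c12 count_predUI !size_filter oddD.
  by move=> /negbTE->; rewrite addbF.
have uX : uniq X by rewrite filter_uniq.
have [r rX] := pairing uX evX.
pose q x := if p x \in A1 then r x else p x.
have rA x : x \in A0 -> p x \in A1 -> [/\ r x \in A0, p (r x) \in A1, r (r x) = x & r x != x].
  by move=> xA pxA; have [|] := rX x; rewrite mem_filter ?pxA ?xA // => /andP[].
have qI : invol q A0.
  move=> x xA; rewrite /q; case: ifP => pxA.
    by have [rxA prA rrx _] := rA x xA pxA; rewrite prA.
  rewrite pp // pA0 ?pxA //; split=> //.
  by case: ifP => // /(nA x xA).
apply: (Sol_split (q := q) (a := a) (F := fun x => x \in U)) => //.
- apply: s0 => // x xA; rewrite /q; case: ifP => pxA; last exact: pU0.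
  have [_ _ _ nr] := rA x xA pxA; rewrite (negbTE nr) -pU0 //.
  by apply/esym/eqP=> pxx; apply: (nA x xA); rewrite -pxx.
- move=> x xA; rewrite /q; case: (boolP (p x \in A1)) => pxA; last by [].
  by have [_ prA _ nr] := rA x xA pxA; rewrite nr prA.
- by move=> x xA; rewrite pU // mem_cat xA orbT.
Qed.

Lemma HP_cat A1 A2 p a1 b1 a2 b2 : HP A1 p a1 b1 -> HP A2 p a2 b2 -> e b1 a2 ->
  HP (A1 ++ A2) p a1 b2.
Proof.
move=> [s1 s1A [p1 <-]] [s2 s2A [p2 <-]] e12; exists (s1 ++ a2 :: s2).
  by rewrite -cat_cons tour_cat perm_cat.
by rewrite cat_path last_cat /= p1 /= p2 andbT.
Qed.

Lemma HP_close A p a b : HP A p a b -> e b a -> Sol A p.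
Proof.
by move=> [s sA [ps <-]] ba; exists (a :: s) => //=; rewrite rcons_path ps.
Qed.

Lemma Sol_HP A p a : invol p A -> Sol A p -> a \in A -> exists2 b, HP A p a b & e b a.
Proof.
move=> pA sol aA; have [s sA] := Sol_open pA sol aA.
by rewrite rcons_path => /andP[ps ba]; exists (p (last a s)) => //; exists s.
Qed.

Lemma HP_perm A B p a b : perm_eq A B -> HP A p a b -> HP B p a b.
Proof. by move=> AB [s sA ps]; exists s => //; apply: perm_trans AB. Qed.

(** The contracted stretch [u], [c], [p c] uses a virtual edge between [u] and [c]; without that
    edge the cycle becomes a path from [u] to [c]. *)
Lemma HP_join A B p u c : invol p A -> uniq A -> p u = u ->
    perm_eq A ((frag p u ++ frag p c ++ [::]) ++ B) ->
    Sol (u :: p c :: B) (joinp p u c) -> HP A p u c.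
Proof.
move=> pA uA pu AE; rewrite -{1}pu.
move/(join_open (s := [::]) pA uA AE) => [s2 s2B ps]; exists (rcons s2 (p c)).
  rewrite (permPr AE) cats0 -catA tour_cons perm_cat2l -cats1 tour_cat tour_cons cats0.
  by rewrite perm_catC perm_cat // frag_inv // (join_ppz (s := [::]) pA AE).
by rewrite ps last_rcons (join_ppz (s := [::]) pA AE).
Qed.

End Tours.

(** * Transport of tours along injective graph homomorphisms *)

Section Iso.

Variables (T T' : eqType) (e : rel T) (e' : rel T') (g : T -> T') (h : T' -> T).
Variables (A : seq T) (p : T -> T) (p' : T' -> T').
Hypotheses (gK : {in A, cancel g h}) (pA : {in A, forall x, p x \in A}).
Hypothesis ge : {in A &, forall x y, e x y -> e' (g x) (g y)}.
Hypothesis gp : {in A, forall x, p' (g x) = g (p x)}.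

Lemma iso_tour s : {subset s <= A} -> tour p' (map g s) = map g (tour p s).
Proof.
move=> sA; rewrite /tour map_flatten -!map_comp; congr flatten.
apply/eq_in_map => x /sA xA /=; rewrite /frag gp // (can_in_eq gK) ?pA //.
by case: ifP.
Qed.

Lemma iso_path x s : x \in A -> {subset s <= A} -> path (lk e p) x s ->
  path (lk e' p') (g x) (map g s).
Proof.
elim: s x => //= y s IHs x xA sA /andP[xy ys].
have yA : y \in A by rewrite sA ?mem_head.
rewrite IHs // ?andbT; first by rewrite /lk gp // ge // pA.
by move=> z zs; rewrite sA // inE zs orbT.
Qed.

Lemma Sol_iso : Sol e A p -> Sol e' (map g A) p'.
Proof.
move=> [s sA cs]; have sub : {subset s <= A}.
  by move=> x xs; rewrite -(perm_mem sA) entry_tour.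
exists (map g s); first by rewrite iso_tour // perm_map.
case: s cs sub {sA} => // x s cs sub; rewrite /= -map_rcons iso_path ?sub ?mem_head //.
by move=> y; rewrite mem_rcons => /sub.
Qed.

Lemma HP_iso a b : HP e A p a b -> HP e' (map g A) p' (g a) (g b).
Proof.
move=> [s sA [ps <-]]; have sub : {subset a :: s <= A}.
  by move=> x xs; rewrite -(perm_mem sA) entry_tour.
exists (map g s); first by rewrite -map_cons iso_tour // perm_map.
rewrite last_map gp ?sub ?mem_last // iso_path ?sub ?mem_head //.
by move=> y ys; rewrite sub // inE ys orbT.
Qed.

End Iso.

Lemma Solv_iso (T T' : eqType) (e : rel T) (e' : rel T') g h A U U' :
    {in A, cancel g h} -> {in A &, forall x y, e x y -> e' (g x) (g y)} ->
    {in A, forall x, (g x \in U') = (x \in U)} ->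
  Solv e A U -> Solv e' (map g A) U'.
Proof.
move=> gK ge gU sA p' pI pU; pose p x := h (p' (g x)).
have gp x : x \in A -> p x \in A /\ p' (g x) = g (p x).
  move=> xA; have [|/mapP[y yA pgx] _] := pI (g x); first exact: map_f.
  by rewrite /p pgx gK.
have pA x : x \in A -> p (p x) = x.
  move=> xA; rewrite {1}/p -(gp x xA).2; have [|_ ->] := pI (g x); first exact: map_f.
  exact: gK.
apply: (@Sol_iso _ _ e e' g h A p) => // [x xA|x xA|]; try by case: (gp x xA).
apply: sA => [x xA|x xA]; first by rewrite pA //; case: (gp x xA).
have [pxA gpx] := gp x xA; rewrite -gU // -pU ?map_f // gpx (can_in_eq gK) //.
Qed.

Lemma HP_rev (T : eqType) (e : rel T) (A : seq T) (p : T -> T) (a b : T) :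
  symmetric e -> invol p A -> HP e A p a b -> HP e A p b a.
Proof.
move=> es pI [s sA [ps pl]].
have sub : {subset a :: s <= A} by move=> x xs; rewrite -(perm_mem sA) entry_tour.
have pp (x : T) : x \in a :: s -> p (p x) = x by move/sub/pI => [].
have aa := pp a (mem_head _ _).
case: (lastP s) sA ps pl pp {sub} => [|s' z] sA ps pl pp.
  rewrite /= in pl; exists [::]; last by rewrite /= -pl aa.
  by rewrite -pl; apply: perm_trans sA; rewrite !tour_cons perm_cat2r frag_inv.
rewrite last_rcons in pl; exists (rcons (rev (map p s')) (p a)).
  apply: perm_trans sA.
  have -> : b :: rcons (rev (map p s')) (p a) = rev (map p (a :: rcons s' z)).
    by rewrite /= rev_cons map_rcons rev_rcons pl.
  by apply: tour_rev_map => x /pp.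
have zz : p (p z) = z by apply: pp; rewrite inE mem_rcons mem_head orbT.
rewrite last_rcons aa; split=> //; rewrite -pl; apply: lk_path_rev => //.
by move=> x xs; apply: pp; rewrite inE mem_rcons inE xs !orbT.
Qed.

(** Free vertices related by [r] are matched greedily; every new pair lowers the number of fixed
    points. *)
Lemma maximal_ext (T : eqType) (r : rel T) (A : seq T) (p : T -> T) :
    symmetric r -> irreflexive r -> invol p A -> {in A, forall x, p x = x \/ r x (p x)} ->
  exists q, [/\ invol q A, {in A, forall x, q x = x \/ r x (q x)},
      {in A, forall x, p x != x -> q x = p x}
    & {in [seq x <- A | q x == x] &, forall x y, ~~ r x y}].
Proof.
move=> rs ri; have [k] := ubnP (count (fun x => p x == x) A).
elim: k p => // k IHk p ck pI pr; pose F := [seq x <- A | p x == x].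
case: (boolP (has (fun x => has (r x) F) F)) => [/hasP[x xF /hasP[y yF xy]]|nF]; last first.
  exists p; split=> // x y xF yF; apply: contra nF => xy; apply/hasP; exists x => //.
  by apply/hasP; exists y.
have [/eqP px xA] : (p x == x) /\ (x \in A) by move: xF; rewrite mem_filter => /andP[].
have [/eqP py yA] : (p y == y) /\ (y \in A) by move: yF; rewrite mem_filter => /andP[].
have nyx : (y == x) = false by apply/eqP => yx; move: xy; rewrite yx ri.
pose q (z : T) := if z == x then y else if z == y then x else p z.
have qo (z : T) : z != x -> z != y -> q z = p z by rewrite /q => /negbTE-> /negbTE->.
have qx : q x = y by rewrite /q eqxx.
have qy : q y = x by rewrite /q nyx eqxx.
have [||z zA|q' [qI qr qk qF]] := IHk q.
- move: ck.
  have := count_predUI (fun z => q z == z) (pred1 x) A.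
  rewrite [count (predI _ _) _](_ : _ = 0) ?addn0; last first.
    rewrite (eq_count (a2 := pred0)) ?count_pred0 // => z /=.
    by case: (eqVneq z x) => [->|]; rewrite ?qx ?nyx ?andbF.
  have : 0 < count (pred1 x) A by rewrite -has_count has_pred1.
  have : count (predU (fun z => q z == z) (pred1 x)) A <= count (fun z => p z == z) A.
    apply: sub_count => z /=; case: (eqVneq z x) => [->|zx]; first by rewrite px eqxx.
    by case: (eqVneq z y) => [->|zy]; rewrite ?py ?eqxx // qo // orbF.
  by clear; lia.
- move=> z zA; case: (eqVneq z x) => [->|zx]; first by rewrite qx qy.
  case: (eqVneq z y) => [->|zy]; first by rewrite qy qx.
  have [pzA ppz] := pI z zA; rewrite qo //; split=> //; rewrite qo //.
    by apply: contra zx => /eqP E; rewrite -ppz E px.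
  by apply: contra zy => /eqP E; rewrite -ppz E py.
- case: (eqVneq z x) => [->|zx]; first by rewrite qx; right.
  case: (eqVneq z y) => [->|zy]; first by rewrite qy rs; right.
  by rewrite qo //; apply: pr.
exists q'; split=> // z zA pz.
have zx : z != x by apply: contra pz => /eqP->; rewrite px.
have zy : z != y by apply: contra pz => /eqP->; rewrite py.
by rewrite qk // qo.
Qed.

(** * The cube *)

Notation vertex := (seq bool).
Implicit Types (x y z d : vertex) (D U A : seq vertex) (i n : nat) (b : bool).

Fixpoint cube n : seq vertex :=
  if n is m.+1 then map (cons false) (cube m) ++ map (cons true) (cube m)
  else [:: [::]].

Fixpoint adj x y {struct x} : bool :=
  match x, y with
  | a :: x', b :: y' => if a (+) b then x' == y' else adj x' y'
  | _, _ => false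
  end.

Fixpoint flip i x {struct x} : vertex :=
  if x is a :: x' then if i is j.+1 then a :: flip j x' else ~~ a :: x' else [::].

Fixpoint ins i b x {struct i} : vertex :=
  match i, x with
  | j.+1, a :: x' => a :: ins j b x'
  | _, _ => b :: x
  end.

Fixpoint del i x {struct x} : vertex :=
  if x is a :: x' then if i is j.+1 then a :: del j x' else x' else [::].

Definition side i x := nth false x i.

Fixpoint par x : bool := if x is a :: x' then a (+) par x' else false.

Lemma mem_cube n x : (x \in cube n) = (size x == n).
Proof.
elim: n x => [|n IHn] [|[] x] //=; rewrite mem_cat.
- by apply/norP; split; apply/mapP => -[].
- rewrite [X in X || _](_ : _ = false) /= ?mem_map ?IHn ?eqSS //; first by move=> ? ? [].
  by apply/mapP => -[].
- rewrite [X in _ || X](_ : _ = false) ?orbF ?mem_map ?IHn ?eqSS //; first by move=> ? ? [].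
  by apply/mapP => -[].
Qed.

Lemma uniq_cube n : uniq (cube n).
Proof.
elim: n => //= n IHn; rewrite cat_uniq !map_inj_uniq ?IHn ?andbT //=; try by move=> ? ? [].
by apply/hasPn => _ /mapP[x _ ->]; apply/mapP => -[].
Qed.

Lemma size_cube n : size (cube n) = 2 ^ n.
Proof. by elim: n => //= n IHn; rewrite size_cat !size_map IHn expnS mul2n addnn. Qed.

Arguments cube : simpl never.

Lemma adj_sym : symmetric adj.
Proof.
elim=> [|a x IHx] [|b y] //=; rewrite addbC [y == x]eq_sym.
by case: ifP => // _; apply: IHx.
Qed.

Lemma size_flip i x : size (flip i x) = size x.
Proof. by elim: x i => [|a x IHx] [|i] //=; rewrite IHx. Qed.

Lemma flipK i : involutive (flip i).
Proof. by move=> x; elim: x i => [|a x IHx] [|i] //=; rewrite ?negbK ?IHx. Qed.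

Lemma adj_flip i x : i < size x -> adj x (flip i x).
Proof.
elim: x i => [|a x IHx] [|i] //= ix; first by rewrite addbN addbb eqxx.
by rewrite addbb IHx.
Qed.

Lemma adj_size x y : adj x y -> size x = size y.
Proof.
elim: x y => [|a x IHx] [|b y] //=; case: ifP => _ => [/eqP->//|/IHx->//].
Qed.

Lemma adjP x y : adj x y -> exists2 i, i < size x & y = flip i x.
Proof.
elim: x y => [|a x IHx] [|b y] //=; case: ifP => ab.
  by move/eqP->; exists 0 => //=; case: a b ab => [] [].
case/IHx=> i ix ->; exists i.+1 => //=; congr cons.
by case: a b ab => [] [].
Qed.

Lemma par_flip i x : i < size x -> par (flip i x) = ~~ par x.
Proof. by elim: x i => [|a x IHx] [|i] //= ix; rewrite ?addNb // IHx // addbN. Qed.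

Lemma adj_par x y : adj x y -> par y = ~~ par x.
Proof. by case/adjP => i ix ->; apply: par_flip. Qed.

Lemma side_flip i x : i < size x -> side i (flip i x) = ~~ side i x.
Proof. by rewrite /side; elim: x i => [|a x IHx] [|i] //= ix; rewrite IHx. Qed.

Lemma adj_side i x y : adj x y -> side i x != side i y -> y = flip i x.
Proof.
rewrite /side; elim: x y i => [|a x IHx] [|b y] [|i] //=; case: ifP => ab.
- by move/eqP->; case: a b ab => [] [].
- by case: a b ab => [] [].
- by move/eqP->; rewrite eqxx.
- by move=> xy sd; rewrite (IHx _ _ xy sd); case: a b ab => [] [].
Qed.

Lemma adj_irr x : adj x x = false.
Proof. by elim: x => //= a x; rewrite addbb. Qed.

Lemma size_ins i b x : size (ins i b x) = (size x).+1.
Proof. by elim: i x => [|i IHi] [|a x] //=; rewrite IHi. Qed.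

Lemma insK i b x : i <= size x -> del i (ins i b x) = x.
Proof. by elim: i x => [|i IHi] [|a x] //= ix; rewrite IHi. Qed.

Lemma delK i x : i < size x -> ins i (side i x) (del i x) = x.
Proof. by rewrite /side; elim: x i => [|a x IHx] [|i] //= ix; rewrite IHx. Qed.

Lemma size_del i x : i < size x -> size (del i x) = (size x).-1.
Proof. by elim: x i => [|a x IHx] [|i] //= ix; rewrite IHx //; case: (x) ix. Qed.

Lemma side_ins i b x : i <= size x -> side i (ins i b x) = b.
Proof. by rewrite /side; elim: i x => [|i IHi] [|a x] //= ix; rewrite IHi. Qed.

Lemma par_ins i b x : i <= size x -> par (ins i b x) = b (+) par x.
Proof. by elim: i x => [|i IHi] [|a x] //= ix; rewrite IHi // addbCA. Qed.

Lemma adj_ins i b x y : i <= size x -> size x = size y ->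
  adj (ins i b x) (ins i b y) = adj x y.
Proof.
elim: i x y => [|i IHi] [|a x] [|c y] //=; rewrite ?addbb // => ix [sxy].
rewrite IHi //; case: ifP => // _; apply/eqP/eqP => [/(congr1 (del i))|->//].
by rewrite !insK -?sxy.
Qed.

(* [D] holds the dead vertices, absent from the graph, and [U] the free ones. *)
Definition alive n D := [seq x <- cube n | x \notin D].

Definition indep U := {in U &, forall x y, ~~ adj x y}.

(** The degree count forced by a Hamilton cycle: a free vertex lies on two of its cube edges and a
    matched vertex on one, each cube edge has one end of each parity, and the whole cube has equally
    many vertices of both parities. *)
Definition bal D U :=
  count par U + count (predC par) D == count (predC par) U + count par D.

Definition conf n D U := [/\ uniq U, {subset U <= cube n}, uniq D, {subset D <= cube n}
  & indep U /\ {in D, forall x, x \notin U}].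

Definition SolvI n := forall D U, conf n D U -> size D <= 1 -> bal D U ->
  Solv adj (alive n D) U.

Definition on_side i b A := [seq x <- A | side i x == b].

Definition half_ok i D U :=
  all (fun b => if size (on_side i b D) <= 1 then bal (on_side i b D) (on_side i b U)
                else false) [:: false; true].

Lemma mem_alive n D x : (x \in alive n D) = (x \notin D) && (size x == n).
Proof. by rewrite mem_filter mem_cube. Qed.

Lemma uniq_alive n D : uniq (alive n D).
Proof. by rewrite filter_uniq ?uniq_cube. Qed.

(** Dropping a coordinate of value [b] shifts every parity by [b], and balance is symmetric in the
    two parities. *)
Lemma bal_del i b D U : {in D, forall x, (i < size x) && (side i x == b)} ->
  {in U, forall x, (i < size x) && (side i x == b)} ->
  bal (map (del i) D) (map (del i) U) = bal D U.
Proof.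
move=> dD dU; have pd A x : {in A, forall x, (i < size x) && (side i x == b)} ->
    x \in A -> par (del i x) = b (+) par x.
  move=> dA /dA/andP[ix /eqP sb]; rewrite -{2}(delK ix) par_ins ?sb ?addKb //.
  by rewrite size_del //; lia.
have cp A : {in A, forall x, (i < size x) && (side i x == b)} ->
   (count par (map (del i) A) = count (fun x => b (+) par x) A) *
   (count (predC par) (map (del i) A) = count (fun x => ~~ (b (+) par x)) A).
  by move=> dA; rewrite !count_map; split; apply: eq_in_count => x xA /=; rewrite (pd A).
rewrite /bal !cp //; case: b {dD dU pd cp} => /=.
  rewrite eq_sym; congr (_ == _); congr (_ + _); apply: eq_count => x /=; case: (par x) => //.
by congr (_ == _); congr (_ + _); apply: eq_count => x /=; case: (par x).
Qed.

Lemma Solv_half n i b D U : SolvI n -> conf n.+1 D U -> i <= n ->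
    size (on_side i b D) <= 1 -> bal (on_side i b D) (on_side i b U) ->
  Solv adj (on_side i b (alive n.+1 D)) U.
Proof.
move=> sI [uU cU uD cD [iU DU]] ilen sD bl.
pose D1 := map (del i) (on_side i b D); pose U1 := map (del i) (on_side i b U).
have sc A x : {subset A <= cube n.+1} -> x \in on_side i b A ->
    [/\ x \in A, size x = n.+1, i < size x, side i x = b & ins i b (del i x) = x].
  move=> cA; rewrite mem_filter => /andP[/eqP sx xA].
  have := cA x xA; rewrite mem_cube => /eqP szx.
  by rewrite -sx delK ?szx //; split.
have mem_del A x : {subset A <= cube n.+1} -> size x = n ->
    (x \in map (del i) (on_side i b A)) = (ins i b x \in A).
  move=> cA sx; apply/mapP/idP => [[y yA ->]|xA].
    by have [yA' _ _ _ ->] := sc A y cA yA.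
  exists (ins i b x); last by rewrite insK ?sx.
  by rewrite mem_filter side_ins ?sx ?eqxx.
have udel A : uniq A -> {subset A <= cube n.+1} -> uniq (map (del i) (on_side i b A)).
  move=> uA cA; rewrite map_inj_in_uniq ?filter_uniq // => x y xA yA.
  have [_ _ _ _ hx] := sc A x cA xA; have [_ _ _ _ hy] := sc A y cA yA.
  by move/(congr1 (ins i b)); rewrite hx hy.
have sdel A x : {subset A <= cube n.+1} -> x \in map (del i) (on_side i b A) -> size x = n.
  by move=> cA /mapP[y yA ->]; have [_ sy iy _ _] := sc A y cA yA; rewrite size_del ?sy.
have s1 : Solv adj (alive n D1) U1.
  apply: sI; last 1 first.
  - rewrite (@bal_del i b) // => x xA.
      by have [_ _ -> -> _] := sc D x cD xA; rewrite eqxx.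
    by have [_ _ -> -> _] := sc U x cU xA; rewrite eqxx.
  - split; rewrite ?udel //.
    + by move=> x /(sdel _ _ cU)/eqP; rewrite mem_cube.
    + by move=> x /(sdel _ _ cD)/eqP; rewrite mem_cube.
    split=> [x y xU yU|x xD].
      have sx := sdel _ _ cU xU; have sy := sdel _ _ cU yU.
      rewrite -(adj_ins (i := i) b) ?sx ?sy //; apply: iU.
        by rewrite -mem_del.
      by rewrite -mem_del.
    have sx := sdel _ _ cD xD; rewrite mem_del //; apply: DU.
    by rewrite -mem_del.
  - by rewrite size_map.
have sz x : x \in alive n D1 -> size x = n by rewrite mem_alive => /andP[_ /eqP].
have gK : {in alive n D1, cancel (ins i b) (del i)} by move=> x /sz sx; rewrite insK ?sx.
apply: (@Solv_perm _ _ (map (ins i b) (alive n D1))); last first.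
  apply: (@Solv_iso _ _ adj adj (ins i b) (del i) _ U1) => // [x y /sz sx /sz sy|x /sz sx].
    by rewrite adj_ins ?sx ?sy.
  by rewrite mem_del.
apply: uniq_perm; rewrite ?map_inj_in_uniq ?filter_uniq ?uniq_cube //.
  exact: can_in_inj gK.
move=> x; rewrite mem_filter mem_alive; apply/mapP/idP => [[y]|].
  rewrite mem_alive => /andP[yD /eqP sy] ->.
  by rewrite side_ins ?sy // eqxx size_ins sy eqxx andbT /= -mem_del.
case/and3P=> /eqP sx xD /eqP szx; exists (del i x); last by rewrite -sx delK ?szx.
by rewrite mem_alive size_del ?szx // eqxx andbT mem_del ?size_del ?szx // -sx delK ?szx.
Qed.

Lemma bal_odd D U : bal D U -> odd (size U) = odd (size D).
Proof.
move/eqP=> bDU; rewrite -(count_predC par U) -(count_predC par D) !oddD.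
have := congr1 odd bDU; rewrite !oddD.
by case: (odd (count par U)); case: (odd (count (predC par) U));
   case: (odd (count par D)); case: (odd (count (predC par) D)).
Qed.

Lemma size_on_side_cube n i b : i <= n -> size (on_side i b (cube n.+1)) = 2 ^ n.
Proof.
move=> ilen; rewrite -size_cube -(size_map (ins i b) (cube n)); apply/perm_size/uniq_perm.
- by rewrite /on_side filter_uniq ?uniq_cube.
- rewrite map_inj_in_uniq ?uniq_cube // => x y; rewrite !mem_cube => /eqP sx /eqP sy.
  by move/(congr1 (del i)); rewrite !insK ?sx ?sy.
move=> x; rewrite mem_filter mem_cube; apply/andP/mapP => [[/eqP sx /eqP szx]|[y]].
  by exists (del i x); rewrite ?mem_cube ?size_del ?szx // -sx delK ?szx.
by rewrite mem_cube => /eqP sy ->; rewrite side_ins ?size_ins sy.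
Qed.

Lemma size_disjoint_filter (T : eqType) (A U D : seq T) (P : pred T) :
  uniq A -> uniq U -> uniq D -> {subset U <= A} -> {subset D <= A} ->
  {in D, forall w, w \notin U} ->
  size (filter P A) =
  count (fun w => w \notin U) (filter P (filter (fun w => w \notin D) A))
    + size (filter P U) + size (filter P D).
Proof.
move=> uA uU uD sU sD dis.
have cU : count (fun w => (w \in U) && P w) A = count P U.
  rewrite -size_filter -(size_filter P U); apply/perm_size/uniq_perm.
  - by rewrite filter_uniq.
  - by rewrite filter_uniq.
  move=> w; rewrite !mem_filter -andbA andbC; case: (boolP (w \in U)) => [/sU->|]; rewrite ?andbT ?andbF //.
have cD : count (fun w => (w \in D) && P w) A = count P D.
  rewrite -size_filter -(size_filter P D); apply/perm_size/uniq_perm.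
  - by rewrite filter_uniq.
  - by rewrite filter_uniq.
  move=> w; rewrite !mem_filter -andbA andbC; case: (boolP (w \in D)) => [/sD->|]; rewrite ?andbT ?andbF //.
rewrite !size_filter -cU -cD -filter_predI count_filter.
elim: A {uA sU sD cU cD} => //= w A ->.
case: (boolP (w \in D)) => [/dis/negbTE->|xD]; case: (w \in U); case: (P w) => /=; lia.
Qed.

(** A half has an even number [2 ^ n] of vertices, and balance makes its free and its dead vertices
    agree in number modulo 2. This is the parity condition of [Solv_split]. *)
Lemma even_alive_half n i b D U : conf n.+1 D U -> i <= n -> 0 < n ->
  bal (on_side i b D) (on_side i b U) ->
  ~~ odd (count (fun x => x \notin U) (on_side i b (alive n.+1 D))).
Proof.
move=> [uU cU uD cD [_ DU]] ilen n0 /bal_odd bl.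
have := size_on_side_cube b ilen; rewrite /on_side /alive.
rewrite (@size_disjoint_filter _ _ U D) ?uniq_cube // => sz.
have : odd (2 ^ n) = false by case: n n0 {uU cU uD cD ilen bl sz} => // n _; rewrite expnS oddM.
rewrite -sz !oddD -/(on_side i b U) -/(on_side i b D) bl -addbA addbb addbF => -> //.
Qed.

(** * Splitting along one direction, with or without sending a free vertex across *)

Section DirectionStep.

Variables (n i : nat).
Hypotheses (ilen : i <= n) (n0 : 0 < n) (sI : SolvI n).

Definition crosses (p : vertex -> vertex) x := side i (p x) != side i x.

(** The crossing pair at [x] is what ties the halves together; without one, solving them separately
    would give two disjoint cycles. *)
Lemma Sol_cross D U p x : conf n.+1 D U -> half_ok i D U ->
    invol p (alive n.+1 D) -> {in alive n.+1 D, forall x, (p x == x) = (x \in U)} ->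
    x \in alive n.+1 D -> crosses p x ->
  Sol adj (alive n.+1 D) p.
Proof.
move=> cf /= ok pA pU xA cx; set A := alive n.+1 D in pA pU xA *.
move: ok; rewrite /half_ok /= andbT; case: ifP => // sf; case: ifP => [st|_]; last by rewrite andbF.
case/andP=> bf bt.
have AE : perm_eq (on_side i false A ++ on_side i true A) A.
  apply: (perm_trans _ (permEl (perm_filterC (fun x => side i x == false) A))).
  rewrite perm_cat2l /on_side.
  by rewrite (eq_filter (a2 := fun x => side i x == true)) // => y /=; case: (side i y).
apply: (Sol_perm AE).
have pA' : invol p (on_side i false A ++ on_side i true A).
  by apply: eq_invol pA; rewrite perm_sym.
have [pxA ppx] := pA x xA.
have [a aA paA] : exists2 a, a \in on_side i false A & p a \in on_side i true A.
  move: cx; rewrite /crosses; case sx: (side i x) => cx.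
    exists (p x); first by rewrite mem_filter pxA andbT; case: (side i (p x)) cx.
    by rewrite mem_filter ppx xA sx.
  exists x; first by rewrite mem_filter xA sx.
  by rewrite mem_filter pxA andbT; case: (side i (p x)) cx.
apply: (Solv_split adj_sym (U := U) (a := a)) => //.
- by rewrite (perm_uniq AE) uniq_alive.
- by move=> y; rewrite (perm_mem AE) => /pU.
- exact: Solv_half.
- exact: Solv_half.
- exact: even_alive_half.
Qed.

(** The path from [y] over its neighbour [z = flip i y] to [p z] is contracted, so [z] dies and [y]
    inherits its partner. Independence of [U] guarantees that [z] is matched. *)
Lemma send_red D U p y : conf n.+1 D U -> y \in U -> flip i y \notin D ->
    invol p (alive n.+1 D) -> {in alive n.+1 D, forall x, (p x == x) = (x \in U)} ->
  [/\ conf n.+1 (flip i y :: D) (rem y U),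
      invol (joinp p y (flip i y)) (alive n.+1 (flip i y :: D)),
      {in alive n.+1 (flip i y :: D),
         forall x, (joinp p y (flip i y) x == x) = (x \in rem y U)},
      forall x, joinp p y (flip i y) x =
        if x == y then p (flip i y) else if x == p (flip i y) then y else p x
    & Sol adj (alive n.+1 (flip i y :: D)) (joinp p y (flip i y)) ->
      Sol adj (alive n.+1 D) p].
Proof.
move=> cf yU zD pA pU; case: (cf) => uU cU uD cD [iU DU].
set z := flip i y in zD *; set A := alive n.+1 D in pA pU *.
have sy : size y = n.+1 by apply/eqP; rewrite -mem_cube cU.
have iy : i < size y by rewrite sy.
have yz : adj y z by apply: adj_flip.
have zU : z \notin U by apply: contraL yz => zU; apply: iU.
have yA : y \in A by rewrite mem_alive sy eqxx andbT; apply: contraL yU => /DU.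
have zA : z \in A by rewrite mem_alive zD size_flip sy eqxx.
have py : p y = y by apply/eqP; rewrite pU.
have pz : p z != z by rewrite pU.
have [pzA ppz] := pA z zA.
have nyz : y != z by apply: contraTneq yz => <-; rewrite adj_irr.
have nypz : y != p z by apply: contraNneq nyz => ypz; rewrite -ppz -ypz py.
pose B := rem y (rem (p z) (rem z A)).
have uA : uniq A by apply: uniq_alive.
have AE : perm_eq A ((frag p y ++ frag p z ++ tour p [::]) ++ B).
  have pzA' : p z \in rem z A by rewrite mem_rem_uniq // !inE pz.
  have yA' : y \in rem (p z) (rem z A).
    by rewrite (mem_rem_uniq _ (rem_uniq _ uA)) inE nypz mem_rem_uniq // inE nyz.
  apply/permP => P; rewrite /frag py eqxx (negbTE pz) /=.
  have := permP (perm_to_rem zA) P; have := permP (perm_to_rem pzA') P.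
  by have := permP (perm_to_rem yA') P; rewrite /= -/B; clear; lia.
have A'E : perm_eq (p y :: p z :: B) (alive n.+1 (z :: D)).
  apply: uniq_perm; rewrite ?uniq_alive ?(uniq_join uA AE) // => x.
  have xA : (x \in A) = [|| x == z, x == y, x == p z | x \in B].
    rewrite (perm_mem AE) /frag py eqxx (negbTE pz) /= !inE.
    by case: (x == z); case: (x == y); case: (x == p z).
  rewrite [RHS]mem_alive inE negb_or -andbA -mem_alive -/A xA !inE py.
  have [->|_] /= := eqVneq x z; last by case: (x == z); case: (x == y); case: (x == p z).
  rewrite [z == y]eq_sym (negbTE nyz) [z == p z]eq_sym (negbTE pz) /=.
  by apply/negbTE; rewrite (join_notB uA AE) // mem_cat !mem_frag eqxx orbT.
have jI : invol (joinp p y z) (alive n.+1 (z :: D)).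
  by apply: eq_invol A'E _; apply: invol_join pA uA AE.
have jE x : joinp p y z x = if x == y then p z else if x == p z then y else p x.
  by rewrite /joinp py.
have cf' : conf n.+1 (z :: D) (rem y U).
  split; rewrite ?rem_uniq //= ?zD //.
  - by move=> x /mem_rem/cU.
  - by move=> x; rewrite inE => /orP[/eqP->|/cD//]; rewrite mem_cube size_flip sy.
  split=> [x x' /mem_rem xU /mem_rem x'U|x]; first exact: iU.
  rewrite inE mem_rem_uniq // inE negb_and => /orP[/eqP->|/DU->]; last by rewrite orbT.
  by rewrite zU orbT.
have jU : {in alive n.+1 (z :: D), forall x, (joinp p y z x == x) = (x \in rem y U)}.
  move=> x; rewrite mem_alive inE negb_or -andbA => /andP[xz]; rewrite -mem_alive -/A => xA.
  rewrite mem_rem_uniq // inE jE; have [->|xy] /= := eqVneq x y.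
    by rewrite eq_sym (negbTE nypz).
  have [->|_] := eqVneq x (p z); last by rewrite pU.
  by rewrite (negbTE nypz) -pU // ppz eq_sym (negbTE pz).
split=> // sol; apply: (Sol_join (s := [::]) adj_sym pA uA AE).
  by rewrite /= /lk !py yz.
by apply: Sol_perm sol; rewrite perm_sym.
Qed.

(** With [z = flip i y], the new pair of [y] and [p z] crosses exactly when the old pair of [z] does
    not, and all other pairs are unchanged. A crossing pair is thus missing afterwards only if the
    pair of [z] was the unique crossing one. *)
Lemma Sol_send D U p y : conf n.+1 D U -> y \in U -> flip i y \notin D ->
    half_ok i (flip i y :: D) (rem y U) ->
    invol p (alive n.+1 D) -> {in alive n.+1 D, forall x, (p x == x) = (x \in U)} ->
  Sol adj (alive n.+1 D) p \/
  {in alive n.+1 D, forall x, crosses p x = (x == flip i y) || (p x == flip i y)}.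
Proof.
move=> cf yU zD ok pA pU; case: (cf) => uU cU uD cD [iU DU].
have [cf' jI jU jE red] := send_red cf yU zD pA pU.
set z := flip i y in zD ok cf' jI jU jE red *; set A := alive n.+1 D in pA pU red *.
have sy : size y = n.+1 by apply/eqP; rewrite -mem_cube cU.
have iy : i < size y by rewrite sy.
have yz : adj y z by apply: adj_flip.
have yA : y \in A by rewrite mem_alive sy eqxx andbT; apply: contraL yU => /DU.
have zA : z \in A by rewrite mem_alive zD size_flip sy eqxx.
have py : p y = y by apply/eqP; rewrite pU.
have [pzA ppz] := pA z zA.
have nyz : y != z by apply: contraTneq yz => <-; rewrite adj_irr.
have solved x : x \in alive n.+1 (z :: D) -> crosses (joinp p y z) x -> Sol adj A p.
  by move=> xA cx; apply: red; apply: (Sol_cross cf' ok jI jU xA cx).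
have yA' : y \in alive n.+1 (z :: D) by rewrite mem_alive inE negb_or nyz -mem_alive.
have sz : side i z = ~~ side i y by apply: side_flip.
have [cz|ncz] := boolP (crosses p z); last first.
  left; apply: (solved y) => //; rewrite /crosses jE eqxx.
  by move: ncz; rewrite /crosses negbK => /eqP->; rewrite sz; case: (side i y).
have [/hasP[x xA /and3P[cx xz pxz]]|/hasPn nx] :=
  boolP (has (fun x => [&& crosses p x, x != z & p x != z]) A); [left|right].
  have [pxA ppx] := pA x xA.
  apply: (solved x); first by rewrite mem_alive inE negb_or xz -mem_alive.
  rewrite /crosses jE; have [xy|_] := eqVneq x y.
    by move: cx; rewrite /crosses xy py eqxx.
  by have [xpz|//] := eqVneq x (p z); move: pxz; rewrite xpz ppz eqxx.
move=> x xA; have [->|xz] /= := eqVneq x z; first exact: cz.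
have [pxz|pxz] := eqVneq (p x) z.
  have [_ ppx] := pA x xA.
  by move: cz; rewrite /crosses -pxz ppx eq_sym.
by apply/negbTE; have := nx x xA; rewrite xz pxz !andbT.
Qed.

End DirectionStep.

Implicit Types (v w : vertex) (L : seq vertex).
Implicit Types (p : vertex -> vertex) (acc pl : seq (vertex * vertex)).

(** * Exhaustive search over matchings *)

(* [has] and [all] with a lazy connective: call-by-value evaluation of [||] and [&&]
   would explore every branch of the searches below. *)
Fixpoint lhas (T : Type) (f : T -> bool) (s : seq T) : bool :=
  if s is x :: s' then if f x then true else lhas f s' else false.
Fixpoint lall (T : Type) (f : T -> bool) (s : seq T) : bool :=
  if s is x :: s' then if f x then lall f s' else false else true.

Lemma lhasE (T : Type) (f : T -> bool) s : lhas f s = has f s.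
Proof. by elim: s => //= x s ->. Qed.

Lemma lallE (T : Type) (f : T -> bool) s : lall f s = all f s.
Proof. by elim: s => //= x s ->. Qed.

Fixpoint pf pl x : vertex :=
  if pl is (a, b) :: pl' then if x == a then b else if x == b then a else pf pl' x else x.

Definition rem2 v w L := [seq x <- L | if x == v then false else x != w].

(* In the search below the remaining vertices carry their partners; the candidates for
   the next entry with few continuations come first. *)
Definition cands x pl :=
  let ks := [seq (count (fun t => adj yp.2 t.1) pl, yp) | yp <- pl & adj x yp.1] in
  flatten [seq [seq ky.2 | ky <- ks & ky.1 == m] | m <- iota 0 6].

(** Prunes a branch in which some unvisited vertex has too few neighbours left among the unvisited
    vertices and the two open ends [x] and [a]: two are required for a free vertex, one besides the
    partner for a matched one. *)
Definition stuck a x pl := lhas (fun zp =>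
  if zp.2 == zp.1 then nat_of_bool (adj zp.1 x) + adj zp.1 a + count (fun t => adj zp.1 t.1) pl < 2
  else if adj x zp.1 then false else if adj a zp.1 then false
  else ~~ lhas (fun t => if adj zp.1 t.1 then t.1 != zp.2 else false) pl) pl.

(** The tour was entered at [a] and has to return there; [x] is its current exit, [pl] lists the
    unvisited vertices with their partners, and [k] is fuel. *)
Fixpoint dfs k a x pl {struct k} : bool :=
  if pl is [::] then adj x a else
  if k is k'.+1 then
    if stuck a x pl then false
    else lhas (fun yp => dfs k' a yp.2
           [seq t <- pl | if t.1 == yp.1 then false else t.1 != yp.2]) (cands x pl)
  else false.

Definition graph p L := [seq (x, p x) | x <- L].

Lemma mem_cands x pl yp : yp \in cands x pl -> (yp \in pl) && adj x yp.1.
Proof.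
case/flattenP=> s /mapP[m _ ->] /mapP[ky]; rewrite mem_filter => /andP[_ /mapP[z]].
by rewrite mem_filter => /andP[xz zL] -> ->; rewrite zL.
Qed.

Lemma rem2_graph p v w L :
  [seq t <- graph p L | if t.1 == v then false else t.1 != w] = graph p (rem2 v w L).
Proof. by rewrite /graph filter_map. Qed.

Definition check_sol p A :=
  if A is a :: A' then dfs (size A') a (p a) (graph p (rem2 a (p a) A')) else false.

Lemma mem_rem2 v w L x : (x \in rem2 v w L) = [&& x != v, x != w & x \in L].
Proof. by rewrite mem_filter; case: eqP. Qed.

Lemma uniq_rem2 v w L : uniq L -> uniq (rem2 v w L).
Proof. exact: filter_uniq. Qed.

Lemma rem2_perm p L y : uniq L -> invol p L -> y \in L ->
  perm_eq (frag p y ++ rem2 y (p y) L) L.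
Proof.
move=> uL pL yL; have [pyL ppy] := pL y yL; apply: uniq_perm => //.
  rewrite cat_uniq uniq_rem2 // andbT; apply/andP; split.
    by rewrite /frag; case: eqP => //= /eqP; rewrite inE eq_sym => ->.
  by apply/hasPn => x; rewrite mem_rem2 /= mem_frag => /and3P[/negbTE-> /negbTE->].
move=> x; rewrite mem_cat mem_frag mem_rem2.
have [->|_] /= := eqVneq x y; first by rewrite yL.
by have [->|_] //= := eqVneq x (p y); rewrite pyL.
Qed.

Lemma invol_rem2 p L y : invol p L -> y \in L -> invol p (rem2 y (p y) L).
Proof.
move=> pL yL x; have [pyL ppy] := pL y yL; rewrite mem_rem2 => /and3P[xy xpy xL].
have [pxL ppx] := pL x xL; split=> //; rewrite mem_rem2 pxL andbT; apply/andP; split.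
  by apply: contraNneq xpy => <-; rewrite ppx.
by apply: contraNneq xy => pxy; rewrite -ppx pxy ppy.
Qed.

Lemma dfsS k a x pl : pl != [::] -> dfs k.+1 a x pl ->
  exists2 yp, (yp \in pl) && adj x yp.1
    & dfs k a yp.2 [seq t <- pl | if t.1 == yp.1 then false else t.1 != yp.2].
Proof.
case: pl => // t pl _; rewrite [dfs _ _ _ _]/=; case: ifP => // _.
by rewrite lhasE => /hasP[yp /mem_cands xyp dyp]; exists yp.
Qed.

Lemma dfsP p k a x L w : uniq L -> invol p L -> p w = x -> dfs k a x (graph p L) ->
  exists2 s, perm_eq (tour p s) L & path (lk adj p) w (rcons s a).
Proof.
elim: k x L w => [|k IHk] x L w uL pL pw; have [->|L0] := eqVneq L [::];
  try by move=> xa; exists [::] => //=; rewrite /lk pw andbT.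
  by case: (L) L0.
move/dfsS => [|_ /andP[/mapP[y yL ->] /= xy]]; first by case: (L) L0.
rewrite rem2_graph => chk.
have [s sL ps] := IHk _ _ y (uniq_rem2 _ _ uL) (invol_rem2 pL yL) (erefl _) chk.
exists (y :: s); last by rewrite /= ps andbT /lk pw.
by rewrite tour_cons -(permPr (rem2_perm uL pL yL)) perm_cat2l.
Qed.

Lemma check_solP p A : uniq A -> invol p A -> check_sol p A -> Sol adj A p.
Proof.
case: A => // a A uA pA; rewrite /check_sol => chk.
have aA : a \in a :: A by rewrite mem_head.
have RE : rem2 a (p a) (a :: A) = rem2 a (p a) A by rewrite /rem2 /= eqxx.
case: (dfsP (w := a) _ _ _ chk) => [|||s sA ps] //; rewrite -?RE.
- exact: uniq_rem2.
- exact: invol_rem2.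
exists (a :: s) => //; rewrite tour_cons -(permPr (rem2_perm uA pA aA)) RE.
by rewrite perm_cat2l.
Qed.

Section Enumeration.

Variables (ok : vertex -> vertex -> bool) (prune f : seq (vertex * vertex) -> bool).

Fixpoint all_match k T acc {struct k} : bool :=
  if prune acc then true else
  if T is v :: T' then
    if k is k'.+1 then
      lall (fun w => if ok v w then all_match k' [seq x <- T' | x != w] ((v, w) :: acc)
                     else true) T'
    else false
  else f acc.

Definition sub_match p A acc :=
  [/\ uniq (unzip1 acc ++ unzip2 acc), {subset unzip1 acc ++ unzip2 acc <= A}
    & all (fun ab => p ab.1 == ab.2) acc].

(** Among the branches of the enumeration, the one agreeing with [p] is followed: it stops at a part
    of [p] where [prune] holds, or with [T] exhausted and [f] true. [acc0] carries pairs put in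
    beforehand, such as the virtual pair in dimension five. *)
Lemma all_matchP p A k T acc acc0 : uniq A -> {subset T <= A} -> uniq T -> invol p T ->
    {in T, forall x, p x != x} -> {in T, forall x, ok x (p x)} ->
    sub_match p A acc -> {in unzip1 acc ++ unzip2 acc, forall x, x \notin T} ->
    all_match k T (acc ++ acc0) ->
  exists pl, [/\ sub_match p A pl, prune (pl ++ acc0)
    \/ f (pl ++ acc0) /\ {subset T <= unzip1 pl ++ unzip2 pl}
    & {subset unzip1 acc ++ unzip2 acc <= unzip1 pl ++ unzip2 pl}].
Proof.
move=> uA; elim: k T acc => [|k IHk] [|v T] acc TA uT pT nT okT sa dis /=;
  case: ifP => // pr; try by move=> h; exists acc; split=> //; (left + right).
have vT : v \in v :: T by rewrite mem_head.
have [pvT ppv] := pT v vT; have npv := nT v vT.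
have {}pvT : p v \in T by move: pvT; rewrite inE (negbTE npv).
rewrite lallE => /allP/(_ _ pvT); rewrite okT // -cat_cons => am.
case: (sa) => ua ca pa; have /andP[vT' uT'] : (v \notin T) && uniq T := uT.
have mT x : x \in [seq x <- T | x != p v] -> [/\ x \in v :: T, x != p v & x != v].
  rewrite mem_filter => /andP[xv xT]; split=> //; first by rewrite inE xT orbT.
  by apply: contraNneq vT' => <-.
have eqm : unzip1 ((v, p v) :: acc) ++ unzip2 ((v, p v) :: acc) =i
           [:: v; p v] ++ (unzip1 acc ++ unzip2 acc).
  by move=> x; rewrite /= !inE !mem_cat inE !orbA [_ || (x == p v)]orbAC.
have [|||||||pl [spl hpl cpl]] := IHk _ ((v, p v) :: acc) _ _ _ _ _ _ _ am.
- by move=> x /mT[xT _ _]; apply: TA.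
- by rewrite filter_uniq.
- move=> x xT; have [xT' xpv xv] := mT x xT; have [pxT ppx] := pT x xT'.
  split=> //; rewrite mem_filter; apply/andP; split.
    by apply: contraNneq xv => pxv; rewrite -ppx pxv ppv.
  by move: pxT; rewrite inE => /orP[/eqP pxv|//]; rewrite -ppx pxv eqxx in xpv.
- by move=> x /mT[xT _ _]; apply: nT.
- by move=> x /mT[xT _ _]; apply: okT.
- split; last by rewrite /= eqxx.
    have pe : perm_eq (unzip1 ((v, p v) :: acc) ++ unzip2 ((v, p v) :: acc))
                      ([:: v; p v] ++ (unzip1 acc ++ unzip2 acc)).
      by rewrite /= perm_cons; apply: (permEl (perm_catCA (unzip1 acc) [:: p v] _)).
    rewrite (perm_uniq pe) cat_uniq ua andbT /= inE eq_sym npv /=.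
    apply/hasPn => x /dis; rewrite !inE; apply: contraNN => /orP[]/eqP->; rewrite ?eqxx //.
    by rewrite pvT orbT.
  move=> x; rewrite eqm mem_cat => /orP[|/ca//]; rewrite !inE => /orP[]/eqP->; first exact: TA.
  by apply: TA; rewrite inE pvT orbT.
- move=> x; rewrite eqm mem_cat => /orP[|/dis].
    by rewrite !inE mem_filter => /orP[]/eqP->; rewrite ?eqxx // (negbTE vT') andbF.
  by apply: contraNN; rewrite mem_filter inE => /andP[_ ->]; rewrite orbT.
have sub x : x \in [:: v; p v] ++ (unzip1 acc ++ unzip2 acc) -> x \in unzip1 pl ++ unzip2 pl.
  by rewrite -eqm; apply: cpl.
exists pl; split=> // [|x xa]; last by apply: sub; rewrite mem_cat xa orbT.
case: hpl => [|[fp Tp]]; [by left|right; split=> // x].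
rewrite inE => /orP[/eqP->|xT]; first by apply: sub; rewrite mem_head.
have [->|xpv] := eqVneq x (p v); first by apply: sub; rewrite !inE eqxx orbT.
by apply: Tp; rewrite mem_filter xpv.
Qed.

Lemma pf_match p A pl acc0 x : invol p A -> sub_match p A pl ->
  pf (pl ++ acc0) x = if x \in unzip1 pl ++ unzip2 pl then p x else pf acc0 x.
Proof.
move=> pA [_]; elim: pl => //= -[a b] pl IHpl /= sub /andP[/eqP pab apl].
rewrite IHpl // => [|y yp]; last first.
  by apply: sub; move: yp; rewrite !(inE, mem_cat) => /orP[]->; rewrite !orbT.
have aA : a \in A by rewrite sub ?mem_head.
have [_ ppa] := pA a aA; rewrite pab in ppa.
rewrite !(inE, mem_cat); have [->|_] /= := eqVneq x a; first by rewrite pab.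
by have [->|_] := eqVneq x b; rewrite ?orbT ?ppa.
Qed.

End Enumeration.

Implicit Types (o : nat * option vertex) (os : seq (nat * option vertex)).

(** * Dimensions three and four *)

(* [(i, None)] stands for splitting along direction [i], and [(i, Some z)] for doing so
   after moving a free vertex to its neighbour [z] across [i]; [okc o x y] holds when the
   matching pair [x], [y] does not make option [o] succeed. *)
Definition opts n D U : seq (nat * option vertex) :=
  flatten [seq (if half_ok i D U then [:: (i, None)] else [::]) ++
               flatten [seq (let z := flip i y in
                             if z \in D then [::] else
                             if half_ok i (z :: D) (rem y U) then [:: (i, Some z)]
                             else [::]) | y <- U]
           | i <- iota 0 n].

Definition okc o x y : bool :=
  if side o.1 x == side o.1 y then
    if o.2 is Some z then if x == z then false else y != z else true
  else if o.2 is Some z then if x == z then true else y == z else false.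

Lemma or_all (T : eqType) (s : seq T) (Q : Prop) (P : T -> Prop) :
  {in s, forall t, Q \/ P t} -> Q \/ {in s, forall t, P t}.
Proof.
elim: s => [|t s IHs] h; first by right.
have [q|pt] := h t (mem_head _ _); first by left.
have hs : {in s, forall t, Q \/ P t} by move=> r rs; apply: h; rewrite inE rs orbT.
have [q|ps] := IHs hs; [by left|right=> r].
by rewrite inE => /orP[/eqP->|/ps].
Qed.

(** Either some option solves [p], or the failure of each option is a constraint on every pair of
    [p]; only matchings obeying all constraints need to be enumerated. *)
Lemma optsP n D U p : SolvI n -> 0 < n -> conf n.+1 D U -> invol p (alive n.+1 D) ->
    {in alive n.+1 D, forall x, (p x == x) = (x \in U)} ->
  Sol adj (alive n.+1 D) p \/
  {in opts n.+1 D U, forall o, {in alive n.+1 D, forall x, okc o x (p x)}}.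
Proof.
move=> sI n0 cf pA pU; apply: or_all => o /flattenP[s /mapP[i + ->]].
rewrite mem_iota add0n ltnS => /= ilen; rewrite mem_cat => /orP[].
  case: ifP => // ok; rewrite inE => /eqP->.
  have [/hasP[x xA cx]|/hasPn nc] := boolP (has (crosses i p) (alive n.+1 D)); [left|right].
    exact: (Sol_cross ilen n0 sI cf ok pA pU xA cx).
  by move=> x /nc; rewrite /crosses negbK /okc /= eq_sym => ->.
case/flattenP=> s' /mapP[y yU ->]; case: ifP => // /negbT zD; case: ifP => // ok.
rewrite inE => /eqP->; have [|h] := Sol_send ilen n0 sI cf yU zD ok pA pU; [by left|right].
move=> x xA; have := h x xA; rewrite /crosses /okc /= [side i x == _]eq_sym.
by case: eqP => _ /=; case: eqP => //= _ /esym; case: eqP.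
Qed.

(** A vertex that should be matched but has no admissible partner shows that no matching obeys the
    constraints; this is tested before the enumeration. *)
Definition chkI os n D U :=
  let A := alive n D in
  let T := [seq x <- A | x \notin U] in
  let ok := fun x y => lall (fun o => okc o x y) os in
  if lhas (fun v => ~~ lhas (fun w => if v == w then false else ok v w) T) T then true
  else all_match ok (fun _ => false) (fun pl => check_sol (pf pl) A) (size T) T [::].

Lemma chkIP os n D U p : conf n D U -> invol p (alive n D) ->
    {in alive n D, forall x, (p x == x) = (x \in U)} ->
    {in os, forall o, {in alive n D, forall x, okc o x (p x)}} ->
  chkI os n D U -> Sol adj (alive n D) p.
Proof.
move=> cf pA pU pos; rewrite /chkI; set A := alive n D in pA pU pos *.
set T := filter _ A; have uA : uniq A by apply: uniq_alive.
have TA x : x \in T -> x \in A /\ p x != x.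
  by rewrite mem_filter => /andP[xU xA]; rewrite pU.
have pT : invol p T.
  move=> x xT; have [xA npx] := TA x xT; have [pxA ppx] := pA x xA.
  by split=> //; rewrite mem_filter pxA -pU // ppx eq_sym npx.
have okT x : x \in T -> lall (fun o => okc o x (p x)) os.
  by move=> /TA[xA _]; rewrite lallE; apply/allP => o /pos/(_ x xA).
case: ifP => [|_].
  rewrite lhasE => /hasP[v vT]; rewrite lhasE => /hasPn/(_ (p v) (pT v vT).1).
  by rewrite eq_sym; case: (TA v vT) => _ /negbTE->; rewrite okT.
move=> am.
have [|||||||pl [spl [//|[+ Tpl]] _]] :=
  all_matchP (p := p) (A := A) (acc := [::]) (acc0 := [::]) uA _ _ _ _ _ _ _ am => //.
- by move=> x /TA[].
- by rewrite filter_uniq.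
- by move=> x /TA[].
rewrite cats0 => chk.
have pE : {in A, pf pl =1 p}.
  move=> x xA; have := pf_match [::] x pA spl; rewrite cats0 => ->; case: ifP => // nx.
  apply/esym/eqP; rewrite pU //; apply: contraFT nx => xU; apply: Tpl.
  by rewrite mem_filter xU.
apply: (eq_Sol pE); apply: check_solP => // x xA; have [pxA ppx] := pA x xA.
by rewrite !pE.
Qed.

Fixpoint isets L : seq (seq vertex) :=
  if L is v :: L' then
    let r := isets L' in r ++ [seq v :: s | s <- r & ~~ has (adj v) s]
  else [:: [::]].

Lemma isetsP L U : indep U -> [seq x <- L | x \in U] \in isets L.
Proof.
move=> iU; elim: L => //= v L IHL; rewrite mem_cat; case: ifP => vU; last by rewrite IHL.
apply/orP; right; apply: map_f; rewrite mem_filter IHL andbT; apply/hasPn => x.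
by rewrite mem_filter => /andP[xU _]; apply: iU.
Qed.

Lemma canon_perm n U : uniq U -> {subset U <= cube n} ->
  perm_eq [seq x <- cube n | x \in U] U.
Proof.
move=> uU cU; apply: uniq_perm; rewrite ?filter_uniq ?uniq_cube // => x.
by rewrite mem_filter; case: (boolP (x \in U)) => // /cU->.
Qed.

Lemma conf_perm n D U V : perm_eq U V -> conf n D U -> conf n D V.
Proof.
move=> UV [uU cU uD cD [iU DU]]; split=> //; first by rewrite -(perm_uniq UV).
  by move=> x; rewrite -(perm_mem UV) => /cU.
split=> [x y|x /DU]; last by rewrite (perm_mem UV).
by rewrite -!(perm_mem UV); apply: iU.
Qed.

Lemma bal_perm D U V : perm_eq U V -> bal D U = bal D V.
Proof. by move=> UV; rewrite /bal !(permP UV). Qed.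

(** The checks run over free sets listed in the order of [cube n]; only membership in the free set
    matters for [Solv]. *)
Lemma Solv_canon n D U : conf n D U -> bal D U ->
    (forall V, V \in isets (cube n) -> conf n D V -> bal D V -> Solv adj (alive n D) V) ->
  Solv adj (alive n D) U.
Proof.
move=> cf bl sol; case: (cf) => uU cU uD cD [iU DU].
have pe := canon_perm uU cU; apply: (@eq_Solv _ _ _ [seq x <- cube n | x \in U]).
  by move=> x _; rewrite (perm_mem pe).
apply: sol; first exact: isetsP.
  by apply: conf_perm cf; rewrite perm_sym.
by rewrite (bal_perm _ pe).
Qed.

(** The base of the reduction: with an empty list of options, no splitting is used and all matchings
    are searched. *)
Lemma check3 : lall (fun D => lall (fun U => if bal D U then chkI [::] 3 D U else true)
  [seq U <- isets (cube 3) | ~~ has (mem U) D]) ([::] :: [seq [:: d] | d <- cube 3]).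
Proof. by vm_compute. Qed.

Lemma SolvI3 : SolvI 3.
Proof.
move=> D U cf sD bl; apply: (Solv_canon cf bl) => V iV cf' bl' p pA pU.
apply: (chkIP (os := [::]) cf' pA pU); first by move=> o.
case: (cf') => _ _ _ cD [_ DV].
have DDs : D \in [::] :: [seq [:: d] | d <- cube 3].
  case: D sD cD {cf bl cf' bl' pA pU DV} => [|d [|]] // _ cD; rewrite inE.
  by apply/orP; right; apply: map_f; rewrite cD ?mem_head.
have VP : V \in [seq U <- isets (cube 3) | ~~ has (mem U) D].
  by rewrite mem_filter iV andbT; apply/hasPn => x /DV.
have := check3; rewrite lallE => /allP/(_ D DDs); rewrite lallE => /allP/(_ V VP).
by rewrite bl'.
Qed.

Fixpoint tr d x {struct d} : vertex :=
  match d, x with a :: d', b :: x' => (a (+) b) :: tr d' x' | _, _ => x end.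

Lemma size_tr d x : size (tr d x) = size x.
Proof. by elim: d x => [|a d IHd] [|b x] //=; rewrite IHd. Qed.

Lemma trK d : involutive (tr d).
Proof. by elim: d => [|a d IHd] [|b x] //=; rewrite addKb IHd. Qed.

Lemma adj_tr d x y : adj (tr d x) (tr d y) = adj x y.
Proof.
elim: d x y => [|a d IHd] [|b x] [|c y] //=.
rewrite -addbA (addbCA b) addKb IHd (inv_eq (trK d)) trK.
by [].
Qed.

Lemma par_tr d x : size d = size x -> par (tr d x) = par d (+) par x.
Proof.
by elim: d x => [|a d IHd] [|b x] //= [/IHd->]; case: a; case: b; case: (par d); case: (par x).
Qed.

Lemma tr_self d : tr d d = nseq (size d) false.
Proof. by elim: d => //= a d ->; rewrite addbb. Qed.

(** Translation by [d] moves the dead vertex to the origin; it shifts all parities alike and so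
    preserves balance. *)
Lemma Solv_tr n d U : size d = n ->
    (forall V, conf n [:: nseq n false] V -> bal [:: nseq n false] V ->
      Solv adj (alive n [:: nseq n false]) V) ->
  conf n [:: d] U -> bal [:: d] U -> Solv adj (alive n [:: d]) U.
Proof.
move=> sd sol [uU cU uD cD [iU DU]] bl; pose o := nseq n false.
have trd : tr d d = o by rewrite tr_self sd.
have pe : perm_eq (map (tr d) (alive n [:: o])) (alive n [:: d]).
  apply: uniq_perm; rewrite ?map_inj_uniq ?uniq_alive //; try exact: inv_inj (trK d).
  move=> x; rewrite -{1}(trK d x) mem_map ?mem_alive ?size_tr; last exact: inv_inj (trK d).
  by rewrite !inE -trd (inj_eq (inv_inj (trK d))).
apply: (Solv_perm pe); apply: (@Solv_iso _ _ adj adj (tr d) (tr d) _ (map (tr d) U)).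
- by move=> x _; apply: trK.
- by move=> x y _ _; rewrite adj_tr.
- by move=> x _; rewrite -{2}(trK d x) mem_map //; apply: inv_inj (trK d).
apply: sol.
  split=> //; first by rewrite map_inj_uniq //; apply: inv_inj (trK d).
  - by move=> _ /mapP[x xU ->]; rewrite mem_cube size_tr -mem_cube cU.
  - by move=> x; rewrite inE => /eqP->; rewrite mem_cube size_nseq.
  split=> [_ _ /mapP[x xU ->] /mapP[y yU ->]|x]; first by rewrite adj_tr iU.
  rewrite inE => /eqP->; rewrite -/o -trd mem_map; last exact: inv_inj (trK d).
  by rewrite DU ?mem_head.
have cnt b : count (fun x => par x == b) (map (tr d) U) = count (fun x => par x == par d (+) b) U.
  rewrite count_map; apply: eq_in_count => x /cU; rewrite mem_cube => /eqP sx /=.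
  by rewrite par_tr ?sd ?sx //; case: (par d); case: (par x); case: b.
have po : par (nseq n false) = false by elim: (n).
move: bl (cnt true) (cnt false); rewrite /bal /= po.
rewrite !(eq_count (a1 := predC par) (a2 := fun x => par x == false)); try by move=> x /=; case: (par x).
rewrite !(eq_count (a1 := par) (a2 := fun x => par x == true)); try by move=> x /=; case: (par x).
by case: (par d) => /= /eqP h -> ->; apply/eqP; lia.
Qed.

(** A one-factorization of the complete graph on the six vertices of [Q_3] other than 000 and 111:
    each of the fifteen pairs occurs in exactly one of the five perfect matchings. All five extend
    to Hamilton cycles of the hexagon that these vertices form. *)
Definition pm6 : seq (seq (vertex * vertex)) :=
  let v1 := [:: true; false; false] in let v2 := [:: false; true; false] in
  let v3 := [:: true; true; false] in let v4 := [:: false; false; true] in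
  let v5 := [:: true; false; true] in let v6 := [:: false; true; true] in
  [:: [:: (v1, v2); (v3, v4); (v5, v6)]; [:: (v1, v3); (v2, v6); (v4, v5)];
      [:: (v1, v4); (v2, v5); (v3, v6)]; [:: (v1, v5); (v2, v3); (v4, v6)];
      [:: (v1, v6); (v2, v4); (v3, v5)]].

Arguments flip : simpl never.

Definition j4 := nseq 4 true.
Definition o4 := nseq 4 false.
Definition low i := on_side i false (alive 4 [:: flip i j4; o4]).
Definition pmi i : seq (seq (vertex * vertex)) :=
  map (map (fun ab => (ins i false ab.1, ins i false ab.2))) pm6.

Lemma pmiP i : i < 4 ->
  {in pmi i, forall pl, Sol adj (low i) (pf pl) /\
    {in low i, forall x, [/\ pf pl x \in low i, pf pl (pf pl x) = x & pf pl x != x]}} /\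
  {in low i &, forall x y, x != y -> exists2 pl, pl \in pmi i & pf pl x = y}.
Proof.
move=> i4; have chk : lall (fun i =>
    lall (fun pl => check_sol (pf pl) (low i) &&
      all (fun x => [&& pf pl x \in low i, pf pl (pf pl x) == x & pf pl x != x]) (low i)) (pmi i)
    && lall (fun x => lall (fun y => (x == y) || lhas (fun pl => pf pl x == y) (pmi i)) (low i))
         (low i)) (iota 0 4) by vm_compute.
move: chk; rewrite lallE => /allP/(_ i); rewrite mem_iota => /(_ i4)/andP[c1 c2].
split=> [pl plP|x y xL yL xy].
  move: c1; rewrite lallE => /allP/(_ pl plP)/andP[cs /allP h].
  have h' : {in low i, forall x, [/\ pf pl x \in low i, pf pl (pf pl x) = x & pf pl x != x]}.
    by move=> x /h/and3P[? /eqP ? ?].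
  split=> //; apply: check_solP => //; first by rewrite filter_uniq ?uniq_alive.
  by move=> x /h'[].
move: c2; rewrite lallE => /allP/(_ x xL); rewrite lallE => /allP/(_ y yL).
by rewrite (negbTE xy) orFb lhasE => /hasP[pl plP /eqP]; exists pl.
Qed.

(** This configuration has no option at all: every direction separates the dead origin from its free
    antipode, leaving unbalanced halves, and moving [j4] across puts two dead vertices into one
    half. It is treated separately for this reason. *)
Lemma conf_oj : conf 4 [:: o4] [:: j4].
Proof.
by split=> //; try (by move=> x; rewrite inE => /eqP->); split=> [x y|x]; rewrite !inE => /eqP-> // /eqP->.
Qed.

Section Antipodal.

Variable p : vertex -> vertex.
Hypotheses (pA : invol p (alive 4 [:: o4]))
  (pU : {in alive 4 [:: o4], forall x, (p x == x) = (x \in [:: j4])}).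

(** Whether a lower vertex is matched into the upper half once [j4] has taken the place of
    [flip i j4]: a partner equal to [flip i j4] therefore counts as upper. *)
Definition tst i (ab : vertex * vertex) :=
  if side i ab.1 then false else if ab.1 == flip i j4 then false
  else if side i ab.2 then true else ab.2 == flip i j4.

Definition cross_low i := [seq x <- low i | tst i (x, p x)].

(* With at least four crossing vertices in the lower half, whose dead vertices are
   antipodal, the pairing left free by Fink's step avoids the three bad ones. *)
Lemma Sol_cross_low i : i < 4 -> 2 < size (cross_low i) -> Sol adj (alive 4 [:: o4]) p.
Proof.
move=> i4 sX; have sz : size (low i) = 6 by case: i i4 {sX} => [|[|[|[|]]]].
pose a := flip i j4.
have aD : a \notin [:: o4] by case: i i4 @a {sX sz} => [|[|[|[|]]]].
have sj : side i j4 by case: i i4 {sX sz a aD} => [|[|[|[|]]]].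
have sa : side i a = false by case: i i4 {sX sz aD sj} @a => [|[|[|[|]]]].
have so : side i o4 = false by case: i i4 {sX sz aD sj sa} @a => [|[|[|[|]]]].
have i3 : i <= 3 by [].
have [cf qI qU qE red] := send_red (n := 3) i3 conf_oj (mem_head _ _) aD pA pU.
rewrite -/a in cf qI qU qE red; set q := joinp p j4 a in qI qU qE red.
apply: red; set A := alive 4 [:: a; o4] in qI qU *.
have rj : rem j4 [:: j4] = [::] by [].
rewrite rj in cf qU; pose hi := on_side i true A.
have AE : perm_eq (low i ++ hi) A.
  apply: (perm_trans _ (permEl (perm_filterC (fun x => side i x == false) A))).
  rewrite perm_cat2l /hi /on_side.
  by rewrite (eq_filter (a2 := fun x => side i x == true)) // => y /=; case: (side i y).
have uLH : uniq (low i ++ hi) by rewrite (perm_uniq AE) uniq_alive.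
have lowA x : x \in low i -> [/\ x \in A, side i x = false & x != a].
  rewrite mem_filter => /andP[/eqP sx xA]; split=> //.
  by move: xA; rewrite mem_alive !inE negb_or => /andP[/andP[]].
have hiE x : x \in A -> (x \in hi) = side i x.
  by move=> xA; rewrite mem_filter xA andbT eqb_id.
have qhi x : x \in low i -> (q x \in hi) = tst i (x, p x).
  move=> xL; have [xA sx xa] := lowA x xL; have [qxA _] := qI x xA.
  rewrite hiE // qE /tst /= sx (negbTE xa).
  have [xj|_] := eqVneq x j4; first by rewrite xj sj in sx.
  have aA : a \in alive 4 [:: o4] by rewrite mem_alive aD size_flip.
  have xA1 : x \in alive 4 [:: o4].
    by move: xA; rewrite !mem_alive inE negb_or => /andP[/andP[_ ->]].
  have [->|npa] := eqVneq x (p a).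
    by rewrite sj (pA aA).2 eqxx; case: (side i a).
  case: ifP => // _; apply/esym/eqP=> pxa.
  by move: npa; rewrite /a -pxa (pA xA1).2 eqxx.
pose N := [seq x <- low i | q x \notin hi].
have sN : size N <= 3.
  have cN : size N = count (predC (fun x => q x \in hi)) (low i) by rewrite size_filter.
  have cX : size (cross_low i) = count (fun x => q x \in hi) (low i).
    by rewrite size_filter; apply: eq_in_count => x xL; rewrite qhi.
  by move: sX (count_predC (fun x => q x \in hi) (low i)); rewrite sz -cN -cX; clear; lia.
have uN : uniq N by rewrite filter_uniq ?filter_uniq ?uniq_alive.
have NL x : x \in N -> [/\ x \in low i, q x \in N, q (q x) = x & q x != x].
  rewrite mem_filter => /andP[nq xL]; have [xA sx xa] := lowA x xL.
  have [qxA qqx] := qI x xA; split=> //; last by rewrite qU.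
  rewrite mem_filter qqx hiE // sx /= mem_filter qxA andbT.
  by move: nq; rewrite hiE //; case: (side i (q x)).
have evN : ~~ odd (size N).
  by apply: (even_free (p := q) uN) => x /NL[].
have [h1 h2] := pmiP i4.
(* [N] is empty or a single pair, and a one-factorization has a member through any given pair. *)
have [pl plP plN] : exists2 pl, pl \in pmi i & {in N, forall x, pf pl x = q x}.
  clearbody N; move: sN evN uN NL; case: N => [|u [|v [|w [|]]]] //= _ _ uN NL.
    by exists (head [::] (pmi i)); first exact: mem_head.
  have [uL quN qqu nqu] := NL u (mem_head _ _).
  have qu : q u = v by move: quN nqu; rewrite !inE => /orP[/eqP->|/eqP]; rewrite ?eqxx.
  have vL : v \in low i by case: (NL v) => //; rewrite !inE eqxx orbT.
  have uv : u != v by rewrite -qu eq_sym.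
  have [pl plP plu] := h2 u v uL vL uv; exists pl => // x.
  have [_ /(_ u uL)[_ pluu _]] := h1 pl plP.
  rewrite !inE => /orP[]/eqP->; first by rewrite plu.
  by rewrite -plu pluu plu -qu qqu.
have [solL plL] := h1 pl plP.
have [/hasP[w wL cw]|/hasPn nc] := boolP (has (fun x => tst i (x, p x)) (low i)); last first.
  suff X0 : cross_low i = [::] by rewrite X0 in sX.
  by rewrite /cross_low -(filter_pred0 (low i)); apply: eq_in_filter => x /nc/negbTE.
apply: (Sol_perm AE); apply: (Sol_split adj_sym (q := pf pl) (a := w) (F := pred0)) => //.
- move=> r rI rF; have s3 : Solv adj hi [::].
    apply: (@Solv_half 3 i true [:: a; o4] [::] SolvI3) => //=; rewrite ?sa ?so //.
  by apply: s3 => // x xA; rewrite rF.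
- by apply: eq_invol qI; rewrite perm_sym.
- by move=> x /plL[].
- move=> x xL; case: ifP => qx; last by rewrite plN // mem_filter qx.
  have [plxL plplx npl] := plL x xL; rewrite npl /=.
  apply: contraTT qx => nq; have plxN : pf pl x \in N by rewrite mem_filter nq.
  have := plN _ plxN; rewrite plplx => xE; have [_ + _ _] := NL _ plxN.
  by rewrite -xE mem_filter => /andP[].
- by rewrite qhi.
- by move=> x xh; rewrite qU // -(perm_mem AE) mem_cat xh orbT.
Qed.

End Antipodal.

(** A partial matching is settled by [Sol_cross_low] as soon as it shows three crossing lower
    vertices for some direction; pairs are counted in both orientations because [tst] looks at the
    first vertex. *)
Definition prune15 acc :=
  lhas (fun i => 2 < count (tst i) (acc ++ [seq (ab.2, ab.1) | ab <- acc])) (iota 0 4).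

Definition T15 := [seq x <- alive 4 [:: o4] | x != j4].

Lemma check15 : all_match (fun _ _ => true) prune15
  (fun pl => check_sol (pf pl) (alive 4 [:: o4])) 14 T15 [::].
Proof. by vm_compute. Qed.

Lemma Sol_antipodal p : invol p (alive 4 [:: o4]) ->
  {in alive 4 [:: o4], forall x, (p x == x) = (x \in [:: j4])} ->
  Sol adj (alive 4 [:: o4]) p.
Proof.
move=> pA pU; pose A := alive 4 [:: o4]; pose T := T15.
have uA : uniq A by apply: uniq_alive.
have TA x : x \in T -> x \in A /\ p x != x.
  by rewrite mem_filter => /andP[xU xA]; rewrite pU // mem_seq1.
have [|||||||pl [spl hpl _]] :=
  all_matchP (p := p) (A := A) (acc := [::]) (acc0 := [::]) uA _ _ _ _ _ _ _ check15.
- by move=> x /TA[].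
- by rewrite filter_uniq.
- move=> x xT; have [xA npx] := TA x xT; have [pxA ppx] := pA _ xA.
  split=> //; rewrite mem_filter pxA andbT.
  by have := pU _ pxA; rewrite ppx mem_seq1 eq_sym (negbTE npx) => <-.
- by move=> x /TA[].
- by [].
- by [].
- by [].
rewrite cats0 in hpl; case: hpl => [|[chk Tpl]].
  rewrite /prune15 lhasE => /hasP[i]; rewrite mem_iota add0n => /= i4 cnt.
  apply: (Sol_cross_low pA pU i4); apply: leq_trans cnt _.
  case: spl => upl spl ppl; set acc2 := pl ++ _.
  have u2 : uniq (unzip1 acc2) by rewrite /unzip1 map_cat -map_comp.
  have p2 ab : ab \in acc2 -> [/\ ab.1 \in A & p ab.1 = ab.2].
    rewrite mem_cat => /orP[abp|/mapP[cd cdp ->]] /=.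
      split; last by apply/eqP; move/allP: ppl => /(_ ab abp).
      by apply: spl; rewrite mem_cat map_f.
    have pcd : p cd.1 = cd.2 by apply/eqP; move/allP: ppl => /(_ cd cdp).
    have cA : cd.1 \in A by apply: spl; rewrite mem_cat map_f.
    by rewrite -pcd; case: (pA _ cA).
  rewrite -size_filter -(size_map fst); apply: uniq_leq_size.
    by apply: subseq_uniq u2; apply: map_subseq; apply: filter_subseq.
  move=> x /mapP[ab]; rewrite mem_filter => /andP[tab /p2[aA pab]] ->.
  rewrite mem_filter pab -surjective_pairing tab mem_filter.
  move: tab aA; rewrite /tst /A !mem_alive !inE; case: (side i ab.1) => //.
  by case: eqP => //= _ _ ->.
have pE : {in A, pf pl =1 p}.
  move=> x xA; have := pf_match [::] x pA spl; rewrite cats0 => ->; case: ifP => // nx.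
  apply/esym/eqP; rewrite pU //; apply: contraFT nx; rewrite mem_seq1 => xj; apply: Tpl.
  by rewrite mem_filter xj.
apply: (eq_Sol pE); apply: check_solP => // x xA; have [pxA ppx] := pA _ xA.
by rewrite !pE.
Qed.

Lemma check4 : lall (fun D => lall (fun U =>
    if bal D U then if (D == [:: o4]) && (U == [:: j4]) then true
                    else chkI (opts 4 D U) 4 D U
    else true) [seq U <- isets (cube 4) | ~~ has (mem U) D]) [:: [::]; [:: o4]].
Proof. by vm_compute. Qed.

Lemma SolvI4 : SolvI 4.
Proof.
have key D V : D \in [:: [::]; [:: o4]] -> V \in isets (cube 4) -> conf 4 D V -> bal D V ->
    Solv adj (alive 4 D) V.
  move=> DP iV cf bl p pA pU; have [_ _ _ cD [_ DV]] := cf.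
  have VP : V \in [seq U <- isets (cube 4) | ~~ has (mem U) D].
    by rewrite mem_filter iV andbT; apply/hasPn => x /DV.
  have := check4; rewrite lallE => /allP/(_ D DP); rewrite lallE => /allP/(_ V VP).
  rewrite bl; case: ifP => [/andP[/eqP DE /eqP VE] _|_ ck].
    by subst D V; apply: Sol_antipodal.
  have [sol|ho] := optsP SolvI3 (erefl _) cf pA pU; first exact: sol.
  exact: (chkIP cf pA pU ho ck).
move=> D U cf sD bl; case: D sD cf bl => [|d [|]] // _ cf bl.
  by apply: (Solv_canon cf bl) => V; apply: key.
have sd : size d = 4 by have [_ _ _ cD _] := cf; apply/eqP; rewrite -mem_cube cD ?mem_head.
apply: (Solv_tr sd) => // V cf' bl'; apply: (Solv_canon cf' bl') => W; exact: key.
Qed.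

Implicit Types (u c k : vertex) (W : seq vertex).

(** * Dimension five *)

Definition real n p := {in cube n, forall x, p x = x \/ adj x (p x)}.
Definition fixpts n p := [seq x <- cube n | p x == x].

(** Pairs that are cube edges cover equally many vertices of each parity, so the same holds for the
    free vertices. *)
Lemma real_bal n p : count par (cube n) = count (predC par) (cube n) ->
  invol p (cube n) -> real n p -> bal [::] (fixpts n p).
Proof.
move=> cb pI pr; pose E b := [seq x <- cube n | (p x != x) && (par x == b)].
have E_le b : size (E b) <= size (E (~~ b)).
  rewrite -(size_map p); apply: uniq_leq_size.
    rewrite map_inj_in_uniq ?filter_uniq ?uniq_cube // => x y.
    rewrite !mem_filter => /andP[_ xc] /andP[_ yc] pxy.
    by rewrite -(pI x xc).2 pxy (pI y yc).2.
  move=> _ /mapP[x + ->]; rewrite !mem_filter => /andP[/andP[npx /eqP px] xc].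
  have [pxc ppx] := pI x xc; rewrite pxc ppx eq_sym npx /= andbT.
  by case: (pr x xc) npx => [->|/adj_par-> _]; rewrite ?eqxx // px.
have Eb : size (E true) = size (E false).
  by apply/eqP; rewrite eqn_leq (E_le true) (E_le false).
have cE b : count (fun x => par x == b) (cube n) =
    count (fun x => par x == b) (fixpts n p) + size (E b).
  rewrite size_filter count_filter; elim: (cube n) => //= x s ->.
  by case: (p x == x); case: (par x == b) => /=; lia.
rewrite /bal /= !addn0; apply/eqP.
have cT A : count par A = count (fun x => par x == true) A.
  by apply: eq_count => x; case: (par x).
have cF A : count (predC par) A = count (fun x => par x == false) A.
  by apply: eq_count => x /=; case: (par x).
by move: cb; rewrite !cT !cF !cE Eb; apply: addIn.
Qed.

Section Kernel5.

Variable brute : bool.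

(** Meant for matchings without a pair crossing [i], when [c], [w], [u] and [k] lie on the same
    side. The other side is then perfectly matched and has a Hamilton cycle, which is cut at the
    neighbour of [w] and inserted between [w] and an adjacent [y]. Which [y] arises is not known in
    advance, so all are checked. *)
Definition detour os D W u k :=
  match D, W with
  | [:: c], [:: w] =>
    lhas (fun o => if o.2 is None then
        let i := o.1 in let b := side i c in
        let A := on_side i b (alive 5 D) in
        let T := [seq x <- A | x \notin [:: w; u; k]] in
        if [&& side i w == b, side i u == b & side i k == b] then
          all_match (fun x y => if adj x y then lall (fun o => okc o x y) os else false)
            (fun _ => false)
            (fun pl => lall (fun y => if adj w y then check_sol (joinp (pf pl) w y)
                                        [seq x <- A | x != y] else true) A)
            (size T) T [:: (u, k)]
        else false
      else false) os
  | _, _ => false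
  end.

(** Cheap exits are an option that succeeds by [quick5], one that the pair [u], [k] makes succeed, a
    vertex without admissible partner, and the detour. Otherwise the matchings obeying the
    constraints are enumerated; unless [brute] is set, any survivor counts as failure. *)
Definition sub5 D W u k :=
  let os := opts 5 D W in
  if lhas (fun o => if o.2 is Some z then if z == k then false else z != u else false) os
  then true
  else if lhas (fun o => ~~ okc o u k) os then true
  else
    let T := [seq x <- alive 5 D | x \notin [:: u, k & W]] in
    let ok := fun x y => if adj x y then lall (fun o => okc o x y) os else false in
    if lhas (fun v => ~~ lhas (ok v) T) T then true
    else if detour os D W u k then true
    else all_match ok (fun _ => false)
           (fun pl => if brute then check_sol (pf pl) (alive 5 D) else false)
           (size T) T [:: (u, k)].

(* A Hamilton path from [u] to [c] is a cycle through the matching in which [u] is joined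
   to the partner [k] of [c]; then [c], unless it is free, becomes dead. *)
Definition chk5 U u :=
  lall (fun c => if c \in U then sub5 [::] (rem u (rem c U)) u c
                 else lall (fun i => let k := flip i c in
                              if k \in U then true else sub5 [:: c] (rem u U) u k) (iota 0 5))
    [seq c <- cube 5 | par c != par u].

End Kernel5.

Definition bits (m : nat) : vertex :=
  [:: odd m; odd m./2; odd m./2./2; odd m./2./2./2; odd m./2./2./2./2].

(* The even free vertices, up to a permutation of the coordinates, when the origin is
   free; [check_cover] shows that the list is complete. *)
Definition reps : seq (seq vertex) := map (map bits)
  [:: [:: 0]; [:: 0; 3]; [:: 0; 15]; [:: 0; 3; 5]; [:: 0; 3; 12]; [:: 0; 3; 15];
      [:: 0; 3; 29]; [:: 0; 15; 23]; [:: 0; 3; 5; 6]; [:: 0; 3; 5; 9];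
      [:: 0; 3; 5; 10]; [:: 0; 3; 5; 15]; [:: 0; 3; 12; 15]; [:: 0; 3; 5; 9; 17]].

Fixpoint subs m L : seq (seq vertex) :=
  if L is v :: L' then
    subs m L' ++ (if m is m'.+1 then map (cons v) (subs m' L') else [::])
  else if m is 0 then [:: [::]] else [::].

(** A matched vertex with five free neighbours has no possible partner along a cube edge, so such a
    [U] is not the free set of a real matching. *)
Definition isolated U := lhas (fun v => if v \in U then false else
  lall (fun i => flip i v \in U) (iota 0 5)) (cube 5).

Definition odd5 Ue := [seq x <- cube 5 | par x && ~~ has (adj x) Ue].

(** A vertex [u] is sought first for which no matching survives the constraints; failing that, the
    survivors are solved by search, and vertices whose antipode [map negb u] is not free are tried
    first. *)
Lemma check5 : lall (fun Ue => lall (fun Uo => let U := Ue ++ Uo in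
    if isolated U then true else if lhas (chk5 false U) Ue then true
    else lhas (chk5 true U) ([seq u <- Ue | map negb u \notin U] ++ Ue)) (subs (size Ue) (odd5 Ue))) reps.
Proof. by vm_compute. Qed.

Definition cperm (s : seq nat) x : vertex := [seq nth false x j | j <- s].

Fixpoint inserts (m : nat) (s : seq nat) : seq (seq nat) :=
  (m :: s) :: (if s is a :: s' then map (cons a) (inserts m s') else [::]).
Fixpoint perms (s : seq nat) : seq (seq nat) :=
  if s is a :: s' then flatten (map (inserts a) (perms s')) else [:: [::]].

Definition is_rep Ue := lhas (fun R => if size R == size Ue then
    lhas (fun s => lall (fun x => cperm s x \in R) Ue) (perms (iota 0 5)) else false) reps.

(** The free odd vertices lie in [nn], the odd vertices without neighbour in [Ue], and balance makes
    them as many as the free even ones; a branch where [nn] is too small is closed. *)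
Fixpoint cover L Ue nn : bool :=
  if L is v :: L' then
    if cover L' Ue nn then
      let nn' := [seq x <- nn | ~~ adj v x] in
      if size nn' < (size Ue).+1 then true else cover L' (v :: Ue) nn'
    else false
  else is_rep Ue.

Lemma check_cover : cover [seq x <- behead (cube 5) | ~~ par x] [:: nseq 5 false]
  (odd5 [:: nseq 5 false]).
Proof. by vm_compute. Qed.

Lemma check_perms : all (perm_eq (iota 0 5)) (perms (iota 0 5)).
Proof. by vm_compute. Qed.

Lemma subsP L U : [seq x <- L | x \in U] \in subs (count (fun x => x \in U) L) L.
Proof.
elim: L => //= v L IHL; rewrite mem_cat; case: (v \in U) => /=; last by rewrite IHL.
by rewrite map_f ?orbT.
Qed.

(** * Soundness of the five-dimensional check, with one virtual pair [u], [k] *)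

Section Sound5.

Variables (p : vertex -> vertex) (D W : seq vertex) (u k : vertex).
Hypotheses (cf : conf 5 D W) (pI : invol p (alive 5 D)).
Hypothesis pW : {in alive 5 D, forall x, (p x == x) = (x \in W)}.
Hypotheses (uA : u \in alive 5 D) (puk : p u = k).
Hypothesis pr : {in alive 5 D, forall x, x \notin W -> x != u -> x != k -> adj x (p x)}.

Let A := alive 5 D.

Lemma s5_pk : p k = u. Proof. by rewrite -puk; case: (pI uA). Qed.

Lemma s5_T x : x \in A -> x \notin [:: u, k & W] ->
  [/\ x \notin W, x != u, x != k, adj x (p x) & p x \notin [:: u, k & W]].
Proof.
move=> xA; rewrite !inE !negb_or => /and3P[xu xk xW]; have [pxA ppx] := pI xA.
split=> //; first exact: pr.
rewrite -(pW pxA) ppx [x == p x]eq_sym pW // xW andbT.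
apply/andP; split; first by apply: contraNneq xk => pxu; rewrite -ppx pxu puk.
by apply: contraNneq xu => pxk; rewrite -ppx pxk s5_pk.
Qed.

(** If moving the free vertex [y] to [z] across [i] failed, the pair of [z] would cross [i]. Since
    [z] is neither [u] nor [k], that pair is a cube edge, so its other end would be [y], which is
    free. *)
Lemma quick5 o : o \in opts 5 D W ->
  (if o.2 is Some z then if z == k then false else z != u else false) -> Sol adj A p.
Proof.
move=> oO; have [//|ho] := optsP SolvI4 (erefl _ : 0 < 4) cf pI pW.
case: (cf) => uW cW _ _ [iW DW]; have {}ho := ho o oO; move: oO.
case/flattenP=> s /mapP[i]; rewrite mem_iota => /= i5 -> ; rewrite mem_cat => /orP[].
  by case: ifP => // _; rewrite inE => /eqP->.
case/flattenP=> s' /mapP[y yW ->]; case: ifP => // /negbT zD; case: ifP => // _.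
rewrite inE => /eqP oE; move: ho; rewrite oE /= => {oE} ho.
have sy : size y = 5 by apply/eqP; rewrite -mem_cube cW.
have yz : adj y (flip i y) by rewrite adj_flip ?sy.
have zA : flip i y \in A by rewrite mem_alive zD size_flip sy.
have zW : flip i y \notin W by apply: contraL yz => zW; apply: iW.
have yA : y \in A by rewrite mem_alive sy andbT; apply: contraL yW => /DW.
case: eqP => // /eqP zk zu; have := ho _ zA; rewrite /okc /=; case: eqP; rewrite ?eqxx // => sd _.
have apz := pr zA zW zu zk; have pzy := adj_side apz (introN eqP sd).
rewrite flipK in pzy; have [_ ppz] := pI zA.
have py : p y = y by apply/eqP; rewrite pW.
by move: yz; rewrite -ppz pzy py adj_irr.
Qed.

Variable os : seq (nat * option vertex).
Hypothesis hos : {in os, forall o, {in A, forall x, okc o x (p x)}}.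

Definition ok5 x y := if adj x y then lall (fun o => okc o x y) os else false.

Lemma s5_ok x : x \in A -> x \notin [:: u, k & W] -> ok5 x (p x).
Proof.
move=> xA xT; have [_ _ _ apx _] := s5_T xA xT; rewrite /ok5 apx lallE.
by apply/allP => o /hos/(_ x xA).
Qed.

Lemma enum5 A1 m f : uniq A1 -> {subset A1 <= A} -> {in A1, forall x, p x \in A1} ->
    u \in A1 ->
    all_match ok5 (fun _ => false) f m [seq x <- A1 | x \notin [:: u, k & W]] [:: (u, k)] ->
  exists2 pl, f pl & {in A1, pf pl =1 p}.
Proof.
move=> uA1 sA pA1 uA1' am; set T := filter _ A1 in am.
have TT x : x \in T -> [/\ x \in A1, x \in A & x \notin [:: u, k & W]].
  by rewrite mem_filter => /andP[xT xA1]; split=> //; apply: sA.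
have I1 : invol p A1 by move=> x xA1; split; [apply: pA1 | case: (pI (sA _ xA1))].
have [|||||||pl [spl [//|[fpl Tpl]] _]] :=
  all_matchP (p := p) (A := A1) (acc := [::]) (acc0 := [:: (u, k)]) uA1 _ _ _ _ _ _ _ am.
- by move=> x /TT[].
- by rewrite filter_uniq.
- move=> x /TT[xA1 xA xT]; have [_ _ _ _ pxT] := s5_T xA xT.
  by rewrite mem_filter pxT pA1 //; split=> //; case: (pI xA).
- by move=> x /TT[xA1 xA xT]; rewrite pW //; have [] := s5_T xA xT.
- by move=> x /TT[xA1 xA xT]; apply: s5_ok.
- by [].
- by [].
exists (pl ++ [:: (u, k)]) => // x xA1; rewrite (pf_match _ _ I1 spl); case: ifP => // nx /=.
have [->|xu] := eqVneq x u; first by rewrite puk.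
have [->|xk] := eqVneq x k; first by rewrite s5_pk.
apply/esym/eqP; rewrite pW ?sA //; apply: contraFT nx => xW; apply: Tpl.
by rewrite mem_filter xA1 !inE !negb_or xu xk xW.
Qed.

Lemma detour5 i c w : D = [:: c] -> W = [:: w] -> (i, None) \in os ->
    (i, None) \in opts 5 D W -> let b := side i c in let A1 := on_side i b A in
    side i w = b -> side i u = b ->
    all_match ok5 (fun _ => false)
      (fun pl => lall (fun y => if adj w y then check_sol (joinp (pf pl) w y)
                                  [seq x <- A1 | x != y] else true) A1)
      (size [seq x <- A1 | x \notin [:: w; u; k]]) [seq x <- A1 | x \notin [:: w; u; k]]
      [:: (u, k)] ->
  Sol adj A p.
Proof.
move=> DE WE oos oop b A1 sw su.
rewrite (eq_filter (a2 := fun x => x \notin [:: u, k & W])); last first.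
  by move=> x; rewrite WE !inE; case: (x == w); case: (x == u); case: (x == k).
move=> am; have nc x : x \in A -> side i (p x) = side i x.
  by move=> xA; have := hos oos xA; rewrite /okc /=; case: eqP.
have [i5 hk] : i < 5 /\ half_ok i D W.
  case/flattenP: oop => s' /mapP[i' i'5 ->]; rewrite mem_cat => /orP[].
    by case: ifP => // hk; rewrite mem_seq1 => /eqP[->]; rewrite mem_iota in i'5.
  by case/flattenP=> t /mapP[y _ ->] /=; do 2![case: ifP => // _]; rewrite mem_seq1 => /eqP.
have hkb b' : size (on_side i b' D) <= 1 /\ bal (on_side i b' D) (on_side i b' W).
  move: hk; rewrite /half_ok /= andbT; case: ifP => // sf; case: ifP => [st|_]; last by rewrite andbF.
  by case/andP=> bf bt; case: b'.
have uA' : uniq A := uniq_alive 5 D.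
have A1P x : (x \in A1) = (x \in A) && (side i x == b) by rewrite mem_filter andbC.
pose A0 := on_side i (~~ b) A.
have A0P x : (x \in A0) = (x \in A) && (side i x == ~~ b) by rewrite mem_filter andbC.
have sol0 : Sol adj A0 p.
  have [s1 bl] := hkb (~~ b); apply: (Solv_half SolvI4 cf _ s1 bl) => // x.
    by rewrite !A0P => /andP[xA sx]; rewrite nc // sx andbT; apply: pI.
  by rewrite A0P => /andP[xA _]; apply: pW.
have I0 : invol p A0.
  by move=> x; rewrite !A0P => /andP[xA sx]; rewrite nc // sx andbT; apply: pI.
have wW : w \in W by rewrite WE mem_head.
case: (cf) => _ cW _ _ [iW DW].
have szw : size w = 5 by apply/eqP; rewrite -mem_cube cW.
have wA : w \in A by rewrite mem_alive szw andbT; apply: contraL wW => /DW.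
have pw : p w = w by apply/eqP; rewrite pW.
pose w' := flip i w.
have sw' : side i w' = ~~ b by rewrite side_flip ?szw ?sw.
have w'A0 : w' \in A0.
  rewrite A0P sw' eqxx andbT mem_alive size_flip szw andbT DE inE.
  by apply/eqP=> wc; move: sw'; rewrite wc -/b; case: (b).
(* [y'] precedes [w'] on the Hamilton cycle of the other half; the detour runs from [w] to [w'],
   around to [y'], and back across [i] to [y]. *)
have [y' [s ts [ps ly']] ay'] := Sol_HP adj_sym I0 sol0 w'A0.
have y'A0 : y' \in A0.
  rewrite -ly'; have [] // := I0 (last w' s); rewrite -(perm_mem ts).
  by apply: entry_tour; apply: mem_last.
have /andP[y'A /eqP sy'] : (y' \in A) && (side i y' == ~~ b) by rewrite -A0P.
have szy' : size y' = 5 by move: y'A; rewrite mem_alive => /andP[_ /eqP].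
pose y := flip i y'.
have ay'y : adj y' y by rewrite adj_flip ?szy'.
have awy : adj w y.
  have e2 x z : size x = 5 -> size z = 5 -> adj x z -> side i x = side i z ->
      adj (flip i x) (flip i z).
    move=> sx sz xz sxz; rewrite -(delK (i := i) (x := flip i x)) ?size_flip ?sx //.
    rewrite -(delK (i := i) (x := flip i z)) ?size_flip ?sz // !side_flip ?sx ?sz // sxz.
    have df t : del i (flip i t) = del i t.
      by elim: t (i) => [|a t IHt] [|j] //=; rewrite IHt.
    rewrite !df adj_ins ?size_del ?sx ?sz //.
    by rewrite -(adj_ins (i := i) (side i z)) ?size_del ?sx ?sz // -{1}sxz !delK ?sx ?sz.
  rewrite -(flipK i w) -/w'; apply: e2 => //; rewrite ?size_flip //; last by rewrite sw' sy'.
  by rewrite adj_sym.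
have sy : side i y = b by rewrite side_flip ?szy' // sy' negbK.
(* Balance of this half gives the dead vertex [c] the parity of the free vertex [w], whereas [y] is
   adjacent to [w]; hence [y] is alive. *)
have yA : y \in A.
  rewrite mem_alive size_flip szy' andbT DE inE; apply/eqP=> yc.
  have [_] := hkb b; rewrite DE WE /on_side /= -/b eqxx sw eqxx /bal /= -yc (adj_par awy).
  by case: (par w).
have yA1 : y \in A1 by rewrite A1P yA sy eqxx.
have wA1 : w \in A1 by rewrite A1P wA sw eqxx.
have yw : y != w by apply: contraTneq awy => ->; rewrite adj_irr.
have npy : p y != y by rewrite pW // WE inE.
have [pyA ppy] := pI yA.
have pyA1 : p y \in A1 by rewrite A1P pyA nc // sy eqxx.
have pyw : p y != w by apply: contraNneq yw => pyw; rewrite -ppy pyw pw.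
pose B := [seq x <- A1 | x \notin [:: w; y; p y]].
have uA1 : uniq A1 by rewrite filter_uniq.
have A1E : perm_eq A1 ([:: w; y; p y] ++ B).
  apply: uniq_perm => //.
    rewrite cat_uniq filter_uniq // andbT /= !inE negb_or ![w == _]eq_sym yw pyw.
    rewrite [y == _]eq_sym npy /=; apply/hasPn => x; rewrite mem_filter => /andP[].
    by rewrite /= !inE.
  move=> x; rewrite mem_cat [x \in B]mem_filter.
  case: (boolP (x \in [:: w; y; p y])) => //= xi.
  by move: xi; rewrite !in_cons in_nil orbF => /or3P[]/eqP->.
have AE01 : perm_eq A (A1 ++ A0).
  rewrite perm_sym; apply: (perm_trans _ (permEl (perm_filterC (fun x => side i x == b) A))).
  rewrite perm_cat2l /A0 /on_side (eq_filter (a2 := predC (fun x => side i x == b))) //.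
  by move=> x /=; case: (side i x); case: (b).
have AE : perm_eq A ((frag p w ++ frag p y ++ tour p (w' :: s)) ++ B).
  rewrite /frag pw eqxx (negbTE npy); apply/permP => P.
  have := permP AE01 P; have := permP A1E P; have := permP ts P.
  by rewrite !count_cat /= ?count_cat; clear; lia.
have A'E : perm_eq (p w :: p y :: B) [seq x <- A1 | x != y].
  apply: uniq_perm; rewrite ?filter_uniq ?(uniq_join uA' AE) // => x.
  rewrite mem_filter (perm_mem A1E) pw mem_cat !in_cons in_nil orbF.
  have [->|xy] := eqVneq x y; last by case: (x == w); case: (x == p y).
  by rewrite (negbTE yw) eq_sym (negbTE npy) /= mem_filter !in_cons eqxx orbT.
have [pl fpl plE] : exists2 pl, lall (fun y => if adj w y then check_sol (joinp (pf pl) w y)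
    [seq x <- A1 | x != y] else true) A1 & {in A1, pf pl =1 p}.
  apply: (enum5 uA1 _ _ _ am) => [x|x|]; first by rewrite A1P => /andP[].
    by rewrite !A1P => /andP[xA /eqP sx]; rewrite nc // sx eqxx andbT; case: (pI xA).
  by rewrite A1P uA su eqxx.
have jE : {in [seq x <- A1 | x != y], joinp (pf pl) w y =1 joinp p w y}.
  by move=> x; rewrite mem_filter => /andP[_ xA1]; rewrite /joinp !plE.
have jI : invol (joinp p w y) [seq x <- A1 | x != y].
  exact: eq_invol A'E (invol_join pI uA' AE).
apply: (Sol_join adj_sym pI uA' AE).
  rewrite /= rcons_path ps /lk !pw ly' ay'y andbT /= adj_flip ?szw //.
rewrite perm_sym in A'E; apply: (Sol_perm A'E); apply: (eq_Sol jE).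
apply: check_solP; first by rewrite filter_uniq.
  move=> x xA; have [jA jj] := jI x xA; by rewrite !jE.
by move: fpl; rewrite lallE => /allP/(_ y yA1); rewrite awy.
Qed.

End Sound5.

Lemma sub5P brute p D W u k : conf 5 D W -> invol p (alive 5 D) ->
    {in alive 5 D, forall x, (p x == x) = (x \in W)} -> u \in alive 5 D -> p u = k ->
    {in alive 5 D, forall x, x \notin W -> x != u -> x != k -> adj x (p x)} ->
  sub5 brute D W u k -> Sol adj (alive 5 D) p.
Proof.
move=> cf pI pW uA puk pr; rewrite /sub5; case: ifP => [|_].
  rewrite lhasE => /hasP[o oO ho] _.
  exact: (quick5 cf pI pW pr oO ho).
have [//|hos] := optsP SolvI4 (erefl _ : 0 < 4) cf pI pW.
case: ifP => [|_].
  by rewrite lhasE => /hasP[o /hos/(_ u uA)]; rewrite puk => ->.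
set T := filter _ _.
case: ifP => [|_].
  rewrite lhasE => /hasP[v]; rewrite mem_filter lhasE => /andP[vT vA] /hasPn/(_ (p v)).
  have [_ _ _ _ pvT] := s5_T pI pW uA puk pr vA vT.
  rewrite mem_filter pvT; case: (pI v vA) => -> _ /(_ isT) /negP; case.
  exact: (s5_ok pI pW uA puk pr hos vA vT).
case: ifP => [|_].
  rewrite /detour; case DE: D => [|c [|]] //; case WE: W => [|w [|]] //.
  rewrite -DE -WE lhasE => /hasP[[i [z|]] oO] //; case: ifP => // /and3P[/eqP sw /eqP su _].
  move=> am _.
  exact: (detour5 cf pI pW uA puk pr hos DE WE oO oO sw su am).
move=> am; have [|//||pl] := enum5 pI pW uA puk pr hos _ _ _ uA am.
- exact: uniq_alive.
- by move=> x xA; case: (pI x xA).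
case: ifP => // _ chk plE; apply: (eq_Sol plE); apply: check_solP => //.
  exact: uniq_alive.
by move=> x xA; have [pxA ppx] := pI x xA; rewrite !plE.
Qed.

Lemma alive0 n : alive n [::] = cube n.
Proof. by rewrite /alive (eq_filter (a2 := predT)) ?filter_predT. Qed.

Lemma chk5P brute p U u c : invol p (cube 5) -> real 5 p -> uniq U -> {subset U <= cube 5} ->
    {in cube 5, forall x, (p x == x) = (x \in U)} -> indep U -> u \in U ->
    chk5 brute U u -> c \in cube 5 -> par c != par u ->
  HP adj (cube 5) p u c.
Proof.
move=> pI pr uU cU pU iU uinU; rewrite /chk5 lallE => /allP/(_ c) chk cc pcu.
have uc : u \in cube 5 by apply: cU.
have pu : p u = u by apply/eqP; rewrite pU.
have ncu : c != u by apply: contraNneq pcu => ->.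
have [pcC ppc] := pI c cc.
have pcu' : p c != u by apply: contraNneq ncu => pcu'; rewrite -ppc pcu' pu.
pose B := [seq x <- cube 5 | x \notin [:: u; c; p c]].
have uC := uniq_cube 5.
have nB x : x \in [:: u; c; p c] -> x \notin B by rewrite mem_filter => ->.
have [nuB [ncB npB]] : u \notin B /\ c \notin B /\ p c \notin B.
  by rewrite !nB // !in_cons eqxx ?orbT.
have uB' : uniq B by rewrite filter_uniq.
have nuc : u != c by rewrite eq_sym.
have nupc : u != p c by rewrite eq_sym.
have AE : perm_eq (cube 5) ((frag p u ++ frag p c ++ [::]) ++ B).
  rewrite cats0 /frag pu eqxx; apply: uniq_perm => //.
    have [pcc|pcc] := eqVneq (p c) c; rewrite /= !in_cons !negb_or.
      by rewrite nuc nuB ncB.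
    by rewrite nuc nupc nuB [c == _]eq_sym pcc ncB npB.
  move=> x; rewrite mem_cat [x \in B]mem_filter.
  have -> : (x \in [:: u] ++ (if p c == c then [:: c] else [:: c; p c])) = (x \in [:: u; c; p c]).
    by case: eqP => [pcc|//]; rewrite /= !inE pcc orbb.
  case: (boolP (x \in [:: u; c; p c])) => //= xi.
  have xi' : [|| x == u, x == c | x == p c] by move: xi; rewrite !inE.
  by case/or3P: xi' => /eqP->.
pose q := joinp p u c.
have qI : invol q (u :: p c :: B).
  by have := invol_join (s := [::]) pI uC AE; rewrite pu.
have uB : uniq (u :: p c :: B) by have := uniq_join (s := [::]) uC AE; rewrite pu.
have qE x : q x = if x == u then p c else if x == p c then u else p x.
  by rewrite /q /joinp pu.
apply: (HP_join adj_sym pI uC pu AE).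
pose D := if c \in U then [::] else [:: c].
pose W := if c \in U then rem u (rem c U) else rem u U.
have WP x : (x \in W) = [&& x \in U, x != u & x != c].
  rewrite /W; case: ifP => cU'.
    rewrite (mem_rem_uniq u (rem_uniq c uU)) inE (mem_rem_uniq c uU) inE.
    by case: (x == u); case: (x == c); case: (x \in U).
  rewrite (mem_rem_uniq u uU) inE.
  by case: (x == u); have [->|_] := eqVneq x c; rewrite ?cU' ?andbT ?andbF.
have DP x : (x \in D) = (x == c) && (c \notin U).
  by rewrite /D; case: ifP => _; rewrite ?inE ?andbT ?andbF.
have cf : conf 5 D W.
  split.
  - by rewrite /W; case: ifP => _; rewrite !rem_uniq.
  - by move=> x; rewrite WP => /and3P[/cU].
  - by rewrite /D; case: ifP.
  - by move=> x; rewrite DP => /andP[/eqP->].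
  split=> [x y|x]; first by rewrite !WP => /and3P[xU _ _] /and3P[yU _ _]; apply: iU.
  by rewrite DP WP => /andP[/eqP-> /negbTE->].
have A'E : perm_eq (u :: p c :: B) (alive 5 D).
  apply: uniq_perm; rewrite ?uniq_alive // => x.
  rewrite mem_alive DP [x \in u :: _]in_cons [x \in p c :: _]in_cons [x \in B]mem_filter.
  rewrite -(mem_cube 5 x); have -> : (x \in [:: u; c; p c]) = [|| x == u, x == c | x == p c].
    by rewrite !inE.
  have [->|xu] := eqVneq x u; first by rewrite uc (negbTE nuc).
  have [xc|xc] := eqVneq x c.
    rewrite xc cc andbT /= ?orbF [c == p c]eq_sym pU //.
    by case: (c \in U).
  by have [->|//] := eqVneq x (p c); rewrite pcC.
rewrite -/q; have A'E2 := A'E; rewrite perm_sym in A'E2; apply: (Sol_perm A'E2).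
have memA x : x \in alive 5 D -> x \in cube 5 by rewrite mem_alive mem_cube => /andP[].
have xcU x : x \in alive 5 D -> x == c -> c \in U.
  by rewrite mem_alive DP => /andP[h _] xc; move: h; rewrite xc negbK.
have sub : sub5 brute D W u (p c).
  have cP : c \in [seq c <- cube 5 | par c != par u] by rewrite mem_filter pcu cc.
  move: (chk cP); rewrite /D /W; case: ifP => cU'.
    by have /eqP-> : p c == c by rewrite pU.
  case: (pr c cc) => [pcc|]; first by rewrite -pU // pcc eqxx in cU'.
  move=> apc; have [i i5 pcE] := adjP apc; rewrite lallE => /allP/(_ i).
  have si : size c = 5 by apply/eqP; rewrite -mem_cube.
  rewrite mem_iota add0n -si => /(_ i5); rewrite -pcE ifN //.
  by rewrite -pU // ppc eq_sym; apply: contraFN cU' => /eqP pcc; rewrite -pU // pcc.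
apply: (sub5P cf _ _ _ _ _ sub).
- exact: eq_invol A'E qI.
- move=> x xA; rewrite qE WP -pU ?memA //; have [->|xu] /= := eqVneq x u.
    by rewrite (negbTE pcu') andbF.
  have [->|xpc] := eqVneq x (p c).
    rewrite eq_sym (negbTE pcu') ppc; apply/esym/negP => /andP[/eqP ccp].
    by rewrite -ccp eqxx.
  have [xc|_] := eqVneq x c; rewrite ?andbT //.
  by move: xpc; rewrite xc eq_sym pU // (xcU x xA) // xc eqxx.
- by rewrite -(perm_mem A'E) mem_head.
- by rewrite qE eqxx.
move=> x xA; rewrite WP => nW xu xpc; rewrite qE (negbTE xu) (negbTE xpc).
case: (pr x (memA x xA)) => // pxx; case/negP: nW; rewrite -pU ?memA // pxx eqxx xu /=.
apply: contra xpc => xc; have cU' := xcU x xA xc.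
by rewrite (eqP xc) eq_sym pU.
Qed.

Implicit Types (a t : vertex) (m : nat).

(** * Reduction of dimension five by coordinate permutations and translations *)

Lemma eq_map_count (T : Type) (f g : T -> bool) (s : seq T) :
  (map f s == map g s) = (count (fun r => f r != g r) s == 0).
Proof. by elim: s => //= r s IHs; rewrite eqseq_cons IHs; case: (f r) (g r) => [] []. Qed.

Lemma adj_map (T : Type) (f g : T -> bool) (s : seq T) :
  adj (map f s) (map g s) = (count (fun r => f r != g r) s == 1).
Proof.
elim: s => //= r s IHs; rewrite IHs eq_map_count.
by case: (f r) (g r) => [] [].
Qed.

Lemma par_map (T : Type) (f : T -> bool) (s : seq T) : par (map f s) = odd (count f s).
Proof. by elim: s => //= r s ->; rewrite oddD; case: (f r). Qed.

Section Perm5.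

Variable s : seq nat.
Hypothesis ss : perm_eq (iota 0 5) s.

Lemma cube5E x : x \in cube 5 -> x = map (nth false x) (iota 0 5).
Proof. by rewrite mem_cube => /eqP sx; rewrite -{1}(mkseq_nth false x) sx. Qed.

Lemma cperm_cube x : cperm s x \in cube 5.
Proof. by rewrite mem_cube size_map -(perm_size ss). Qed.

Lemma adj_cperm x y : x \in cube 5 -> y \in cube 5 -> adj (cperm s x) (cperm s y) = adj x y.
Proof.
move=> /cube5E xE /cube5E yE.
by rewrite {2}xE {2}yE !adj_map (permP ss).
Qed.

Lemma par_cperm x : x \in cube 5 -> par (cperm s x) = par x.
Proof. by move=> /cube5E xE; rewrite {2}xE !par_map (permP ss). Qed.

Definition inv_perm := [seq index j s | j <- iota 0 5].

Lemma cpermK x : x \in cube 5 -> cperm inv_perm (cperm s x) = x.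
Proof.
move=> xc; rewrite [RHS](cube5E xc) /cperm -map_comp; apply/eq_in_map => j ji /=.
have js : j \in s by rewrite -(perm_mem ss).
by rewrite (nth_map 0) ?index_mem // nth_index.
Qed.

End Perm5.

Section Conj.

Variables (g h : vertex -> vertex) (p : vertex -> vertex).
Hypotheses (gc : {in cube 5, forall x, g x \in cube 5}) (gK : {in cube 5, cancel g h}).
Hypothesis ga : {in cube 5 &, forall x y, adj (g x) (g y) = adj x y}.
Hypotheses (pI : invol p (cube 5)) (pr : real 5 p) (iF : indep (fixpts 5 p)).

Lemma cj_surj x : x \in cube 5 -> exists2 y, y \in cube 5 & x = g y.
Proof.
move=> xc; have : x \in map g (cube 5).
  have [_ ->] // : (size (map g (cube 5)) = size (cube 5)) * (map g (cube 5) =i cube 5).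
  apply: uniq_min_size; last by rewrite size_map.
    by rewrite map_inj_in_uniq ?uniq_cube //; apply: can_in_inj gK.
  by move=> _ /mapP[y yc ->]; apply: gc.
by case/mapP=> y yc ->; exists y.
Qed.

Definition cj x := g (p (h x)).

Lemma cjE x : x \in cube 5 -> cj (g x) = g (p x).
Proof. by move=> xc; rewrite /cj gK. Qed.

Lemma cj_invol : invol cj (cube 5).
Proof.
move=> _ /cj_surj[y yc ->]; have [pyc ppy] := pI yc.
by rewrite cjE // gc // cjE // ppy.
Qed.

Lemma cj_real : real 5 cj.
Proof.
move=> _ /cj_surj[y yc ->]; have [pyc ppy] := pI yc; rewrite cjE //.
by case: (pr yc) => [->|ay]; [left|right; rewrite ga].
Qed.

Lemma cj_fix x : x \in cube 5 -> (cj (g x) == g x) = (p x == x).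
Proof.
by move=> xc; rewrite cjE // (inj_in_eq (can_in_inj gK)) //; case: (pI xc).
Qed.

Lemma cj_indep : indep (fixpts 5 cj).
Proof.
move=> x y; rewrite !mem_filter => /andP[fx /cj_surj[x' xc xE]] /andP[fy /cj_surj[y' yc yE]].
rewrite xE yE ga //; apply: iF; rewrite mem_filter ?xc ?yc andbT.
  by rewrite -cj_fix // -xE.
by rewrite -cj_fix // -yE.
Qed.

Lemma cj_HP u c : u \in cube 5 -> c \in cube 5 -> HP adj (cube 5) cj (g u) (g c) ->
  HP adj (cube 5) p u c.
Proof.
move=> uc cc hp; have hK : {in cube 5, cancel h g}.
  by move=> _ /cj_surj[y yc ->]; rewrite gK.
have hc x : x \in cube 5 -> h x \in cube 5.
  by case/cj_surj=> y yc ->; rewrite gK.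
have hp' : HP adj (map h (cube 5)) p (h (g u)) (h (g c)).
  apply: (HP_iso (g := h) (h := g) (e := adj) (p := cj)) hp => //.
  - by move=> x xc; case: (cj_invol xc).
  - move=> x y xc yc; rewrite -{1}(hK x xc) -{1}(hK y yc) ga //; apply: hc => //.
  - by move=> x xc; rewrite /cj gK //; case: (pI (hc x xc)).
rewrite !gK // in hp'; apply: HP_perm hp'; apply: uniq_perm.
- by rewrite map_inj_in_uniq ?uniq_cube //; apply: can_in_inj hK.
- exact: uniq_cube.
move=> x; apply/mapP/idP => [[y yc ->]|xc]; first exact: hc.
by exists (g x); rewrite ?gK // gc.
Qed.

End Conj.

Lemma cnt5 : count par (cube 5) = count (predC par) (cube 5).
Proof. by vm_compute. Qed.

Lemma repsP R : R \in reps -> uniq R /\ {in R, forall x, x \in cube 5 /\ ~~ par x}.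
Proof.
have chk : all (fun R => uniq R && all (fun x => (size x == 5) && ~~ par x) R) reps.
  by vm_compute.
move/(allP chk) => /andP[uR /allP h]; split=> // x /h/andP[sx px].
by rewrite mem_cube.
Qed.

Definition good5 p b := exists2 u, [/\ u \in cube 5, par u = b & p u = u]
  & {in cube 5, forall c, par c = ~~ b -> HP adj (cube 5) p u c}.

Lemma five_rep p R : invol p (cube 5) -> real 5 p -> indep (fixpts 5 p) -> R \in reps ->
    {in fixpts 5 p, forall x, ~~ par x -> x \in R} ->
    count (predC par) (fixpts 5 p) = size R ->
  good5 p false.
Proof.
move=> pI pr iF RP sub sz; have [uR RE] := repsP RP; set F := fixpts 5 p in iF sub sz *.
have uF : uniq F by rewrite filter_uniq ?uniq_cube.
have FP x : (x \in F) = (p x == x) && (x \in cube 5) by rewrite mem_filter.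
(* The free even vertices form a subset of [R] of the same size, hence all of [R]. *)
have RF x : x \in R -> x \in F.
  pose E := [seq x <- F | ~~ par x].
  have [_ eER] : (size E = size R) * (E =i R).
    apply: uniq_min_size; first by rewrite filter_uniq.
      by move=> y; rewrite mem_filter => /andP[py yF]; apply: sub.
    by rewrite size_filter sz.
  by rewrite -eER mem_filter => /andP[].
pose Uo := [seq x <- odd5 R | x \in F]; pose U := R ++ Uo.
have UoP x : (x \in Uo) = (x \in F) && par x.
  rewrite [x \in Uo]mem_filter [x \in odd5 R]mem_filter.
  case: (boolP (x \in F)) => //= xF; case: (boolP (par x)) => //= px.
  have xc : x \in cube 5 by move: xF; rewrite FP => /andP[].
  have nh : ~~ has (adj x) R by apply/hasPn => y /RF yF; apply: iF.
  by rewrite nh xc.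
have UP x : (x \in U) = (x \in F).
  rewrite mem_cat UoP; case: (boolP (x \in F)) => xF /=; last first.
    by rewrite orbF; apply: contraNF xF => /RF.
  by case: (boolP (par x)) => [|/(sub x xF)->]; rewrite ?orbT.
have uU : uniq U.
  rewrite cat_uniq uR filter_uniq ?filter_uniq ?uniq_cube // andbT /=.
  apply/hasPn => x; rewrite UoP => /andP[_ px]; apply/negP => /RE[_].
  by rewrite px.
have sUo : size Uo = size R.
  have : count par F = count (predC par) F.
    by have /eqP := real_bal cnt5 pI pr; rewrite /= !addn0.
  rewrite sz => <-; rewrite -size_filter; apply/perm_size/uniq_perm.
  - by rewrite filter_uniq ?filter_uniq ?uniq_cube.
  - by rewrite filter_uniq.
  by move=> x; rewrite UoP [RHS]mem_filter andbC.
have sP : Uo \in subs (size R) (odd5 R).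
  have := subsP (odd5 R) F; rewrite -size_filter -/Uo sUo; exact.
have cU : {subset U <= cube 5} by move=> x; rewrite UP FP => /andP[].
have pU : {in cube 5, forall x, (p x == x) = (x \in U)}.
  by move=> x xc; rewrite UP FP xc andbT.
have iU : indep U by move=> x y; rewrite !UP; apply: iF.
have key br u : u \in R -> chk5 br U u -> good5 p false.
  move=> uR' chk; have [ucu pu] := RE u uR'; exists u.
    by split=> //; [apply: negbTE|apply/eqP; rewrite pU // mem_cat uR'].
  move=> c cc pc; apply: (chk5P pI pr uU cU pU iU _ chk cc).
    by rewrite mem_cat uR'.
  by rewrite pc (negbTE pu).
have := check5; rewrite lallE => /allP/(_ R RP); rewrite lallE => /allP/(_ Uo sP).
cbv zeta; rewrite -/U; case: ifP => [|_].
  rewrite /isolated lhasE => /hasP[v vc]; case: ifP => // /negbT vU.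
  rewrite lallE => /allP h _; case: (pr v vc) => [pv|/adjP[i iv pv]].
    by rewrite -pU // pv eqxx in vU.
  have sv : size v = 5 by apply/eqP; rewrite -mem_cube.
  have /h : i \in iota 0 5 by rewrite mem_iota add0n -sv.
  have [pvc ppv] := pI v vc; rewrite -pv -pU // ppv => /eqP vp.
  by rewrite -pU // -vp eqxx in vU.
case: ifP => [|_].
  by rewrite lhasE => /hasP[u uR' chk] _; apply: key chk.
rewrite lhasE => /hasP[u + chk]; rewrite mem_cat mem_filter => uRR; apply: key chk.
by case/orP: uRR => // /andP[].
Qed.

Lemma coverP U Uo L Ue nn : uniq Uo -> {subset Uo <= nn} ->
    {in L, forall v, v \in U -> {in Uo, forall x, ~~ adj v x}} ->
    size Ue + count (fun x => x \in U) L <= size Uo -> cover L Ue nn ->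
  exists2 E, is_rep E & perm_eq E (Ue ++ [seq x <- L | x \in U]).
Proof.
move=> uo; elim: L Ue nn => [|v L IHL] Ue nn sub na sz /=.
  by move=> rE; exists Ue; rewrite ?cats0.
have naL : {in L, forall v, v \in U -> {in Uo, forall x, ~~ adj v x}}.
  by move=> w wL; apply: na; rewrite inE wL orbT.
case: ifP => // cL; move: sz => /=; case: (boolP (v \in U)) => vU sz; last first.
  by move=> _; apply: (IHL Ue nn).
have sub' : {subset Uo <= [seq x <- nn | ~~ adj v x]}.
  by move=> x xo; rewrite mem_filter sub // andbT; apply: na; rewrite ?mem_head.
case: ifP => [lt|_].
  by have := uniq_leq_size uo sub'; move: sz lt; rewrite /=; clear; lia.
move/(IHL _ _ sub' naL) => [|E rE pE]; first by move: sz; rewrite /=; clear; lia.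
exists E => //; apply: (perm_trans pE).
by rewrite -cat_rcons -cats1 perm_cat2r (perm_catC [:: v]).
Qed.

Lemma five_zero p : invol p (cube 5) -> real 5 p -> indep (fixpts 5 p) ->
  p (nseq 5 false) = nseq 5 false -> good5 p false.
Proof.
move=> pI pr iF p0; set F := fixpts 5 p; set o := nseq 5 false in p0.
pose L := [seq x <- behead (cube 5) | ~~ par x].
have cE : cube 5 = o :: behead (cube 5) by [].
have oc : o \in cube 5 by rewrite mem_cube.
have oF : o \in F by rewrite mem_filter p0 eqxx.
pose Uo := [seq x <- F | par x].
have uF : uniq F by rewrite filter_uniq ?uniq_cube.
have FP x : (x \in F) = (p x == x) && (x \in cube 5) by rewrite mem_filter.
have bl : count par F = count (predC par) F.
  by have /eqP := real_bal cnt5 pI pr; rewrite /= !addn0.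
have evE : perm_eq [seq x <- F | ~~ par x] ([:: o] ++ [seq x <- L | x \in F]).
  apply: uniq_perm; first by rewrite filter_uniq.
    have /andP[oB uB] : (o \notin behead (cube 5)) && uniq (behead (cube 5)).
      by rewrite -cons_uniq -cE uniq_cube.
    have uL : uniq L by apply: filter_uniq.
    rewrite cat1s cons_uniq (filter_uniq _ uL) andbT; apply/negP.
    rewrite mem_filter => /andP[_]; rewrite [o \in L]mem_filter => /andP[_].
    by apply/negP.
  move=> x; rewrite mem_cat mem_seq1 [LHS]mem_filter [X in _ || X]mem_filter [x \in L]mem_filter FP.
  have -> : (x \in cube 5) = (x == o) || (x \in behead (cube 5)) by rewrite {1}cE in_cons.
  have [->|] := eqVneq x o; first by rewrite p0 eqxx.
  by case: (p x == x); case: (par x); case: (x \in behead _).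
have [||||E rE pE] := @coverP F Uo L [:: o] (odd5 [:: o]) _ _ _ _ check_cover.
- by rewrite filter_uniq.
- move=> x; rewrite mem_filter => /andP[px xF]; rewrite mem_filter px /= orbF.
  have xc : x \in cube 5 by move: xF; rewrite FP => /andP[].
  by rewrite xc andbT; apply: iF.
- by move=> v _ vF x; rewrite mem_filter => /andP[_ xF]; apply: iF.
- have := perm_size evE; rewrite size_cat !size_filter => <-; rewrite bl.
  exact: leqnn.
have {}pE : perm_eq E [seq x <- F | ~~ par x].
  by rewrite perm_sym in evE; apply: perm_trans pE evE.
move: rE; rewrite /is_rep lhasE => /hasP[R RP]; case: ifP => // /eqP sR.
rewrite lhasE => /hasP[s sP]; rewrite lallE => /allP sub.
have ss : perm_eq (iota 0 5) s by apply: (allP check_perms).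
pose g := cperm s; pose h := cperm (inv_perm s).
have gc : {in cube 5, forall x, g x \in cube 5} by move=> x _; apply: cperm_cube.
have gK : {in cube 5, cancel g h} by move=> x xc; apply: cpermK.
have ga : {in cube 5 &, forall x y, adj (g x) (g y) = adj x y}.
  by move=> x y xc yc; apply: adj_cperm.
have gF x : x \in cube 5 -> (g x \in fixpts 5 (cj g h p)) = (x \in F).
  by move=> xc; rewrite FP mem_filter (cj_fix gK pI xc) gc // xc.
have [||u' [uc pu fu] hp] :=
  @five_rep (cj g h p) R (cj_invol gc gK pI) (cj_real gc gK ga pI pr) (cj_indep gc gK ga pI iF) RP.
- move=> x xF px; have xc : x \in cube 5 by move: xF; rewrite mem_filter => /andP[].
  have [y yc xE] := cj_surj gc gK xc; rewrite xE; apply: sub.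
  by rewrite (perm_mem pE) mem_filter -(par_cperm ss yc) -/(g y) -xE px -gF // -xE.
- rewrite sR (perm_size pE) size_filter -!size_filter -(size_map g [seq x <- F | _]).
  apply/perm_size/uniq_perm; first by rewrite !filter_uniq ?uniq_cube.
    rewrite map_inj_in_uniq ?filter_uniq // => x y.
    rewrite !mem_filter => /andP[_ /andP[_ xc]] /andP[_ /andP[_ yc]].
    exact: (can_in_inj gK).
  move=> x; apply/idP/mapP => [|[y]].
    rewrite mem_filter => /andP[px xF].
    have xc : x \in cube 5 by move: xF; rewrite mem_filter => /andP[].
    have [y yc xE] := cj_surj gc gK xc; exists y => //.
    by rewrite mem_filter -gF // -xE xF andbT -(par_cperm ss yc) -/(g y) -xE.
  rewrite mem_filter => /andP[py yF] ->.
  have yc : y \in cube 5 by move: yF; rewrite FP => /andP[].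
  by rewrite mem_filter gF // yF andbT /= par_cperm.
have [u uc' uE] := cj_surj gc gK uc; exists u.
  split=> //; first by rewrite -(par_cperm ss uc') -/(g u) -uE.
  by apply/eqP; rewrite -(cj_fix gK pI uc') -uE fu.
move=> c cc pc; apply: (cj_HP gc gK ga pI uc' cc); rewrite -uE; apply: hp; first exact: gc.
by rewrite par_cperm.
Qed.

(** Balance provides a free vertex of parity [b]; translating it to the origin shifts all parities
    by [b], so that the even case serves for both. *)
Lemma five p b : invol p (cube 5) -> real 5 p -> indep (fixpts 5 p) ->
  fixpts 5 p != [::] -> good5 p b.
Proof.
move=> pI pr iF nF; set F := fixpts 5 p in iF nF.
have [u0 u0F pu0] : exists2 u0, u0 \in F & par u0 = b.
  have /eqP := real_bal cnt5 pI pr; rewrite /= !addn0 -/F => bl.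
  have : has (fun x => par x == b) F.
    rewrite has_count; have := count_predC par F; rewrite -bl => sF.
    have c0 : 0 < count par F by case: (F) nF sF => //= x s _; clear; lia.
    case: (b); first by rewrite (eq_count (a2 := par)) // => x; case: (par x).
    rewrite (eq_count (a2 := predC par)) -?bl // => x /=; by case: (par x).
  by case/hasP=> x xF /eqP; exists x.
have [/eqP fu0 u0c] : (p u0 == u0) /\ u0 \in cube 5 by move: u0F; rewrite mem_filter => /andP[].
have su0 : size u0 = 5 by apply/eqP; rewrite -mem_cube.
pose g := tr u0.
have gc : {in cube 5, forall x, g x \in cube 5} by move=> x; rewrite !mem_cube size_tr.
have gK : {in cube 5, cancel g g} by move=> x _; apply: trK.
have ga : {in cube 5 &, forall x y, adj (g x) (g y) = adj x y} by move=> x y _ _; apply: adj_tr.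
have gp x : x \in cube 5 -> par (g x) = b (+) par x.
  by rewrite mem_cube => /eqP sx; rewrite par_tr ?su0 ?sx // pu0.
have g0 : g u0 = nseq 5 false by rewrite /g tr_self su0.
have [|u' [uc pu fu] hp] := @five_zero (cj g g p) (cj_invol gc gK pI)
   (cj_real gc gK ga pI pr) (cj_indep gc gK ga pI iF).
  by rewrite -g0 cjE // fu0.
have [u uc' uE] := cj_surj gc gK uc; exists u.
  split=> //; first by have := gp u uc'; rewrite -uE pu; case: (b); case: (par u).
  by apply/eqP; rewrite -(cj_fix gK pI uc') -uE fu.
move=> c cc pc; apply: (cj_HP gc gK ga pI uc' cc); rewrite -uE; apply: hp; first exact: gc.
by rewrite gp // pc; case: (b).
Qed.

(** * Perfect matchings and layers *)

Lemma mem_half n i b x : i <= n ->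
  (x \in map (ins i b) (cube n)) = (size x == n.+1) && (side i x == b).
Proof.
move=> il; apply/mapP/andP => [[y]|[/eqP sx /eqP sb]].
  by rewrite mem_cube => /eqP sy ->; rewrite size_ins sy side_ins ?sy // !eqxx.
exists (del i x); first by rewrite mem_cube size_del sx.
by rewrite -sb delK // sx.
Qed.

(** The direction is chosen to separate the origin from its partner, which guarantees a crossing
    pair. In dimension one the tour has a single entry and uses the only edge both as a pair and as
    a link. *)
Lemma fink n : Solv adj (cube n.+1) [::].
Proof.
elim: n => [|n IHn] p pI pU.
  have x0 : [:: false] \in cube 1 by rewrite mem_cube.
  have E : p [:: false] = [:: true].
    have [p0 _] := pI _ x0; have := pU _ x0; rewrite in_nil => /negbT.
    by case: (p _) p0 => [|[] [|? ?]]; rewrite ?mem_cube ?eqxx.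
  exists [:: [:: false]]; first by rewrite /tour /= /frag E.
  by rewrite /= /lk E.
pose x0 := nseq n.+2 false.
have x0c : x0 \in cube n.+2 by rewrite mem_cube size_nseq.
have [px0 _] := pI _ x0c.
have [i il si] : exists2 i, i < n.+2 & side i x0 != side i (p x0).
  case: (boolP (has (fun i => side i x0 != side i (p x0)) (iota 0 n.+2))).
    by case/hasP=> i; rewrite mem_iota => /andP[_ il] si; exists i.
  move/hasPn => h; have := pU _ x0c; rewrite in_nil => /negP[].
  rewrite mem_cube in px0; apply/eqP/(eq_from_nth (x0 := false)).
    by rewrite (eqP px0) size_nseq.
  move=> j; rewrite (eqP px0) => jn; apply/esym/eqP; rewrite -[_ == _]negbK.
  by apply: h; rewrite mem_iota.
have sH b : Solv adj (map (ins i b) (cube n.+1)) [::].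
  apply: (Solv_iso (h := del i) _ _ _ IHn) => // x.
    by rewrite mem_cube => /eqP sx; rewrite insK ?sx.
  by move=> y; rewrite !mem_cube => /eqP sx /eqP sy; rewrite adj_ins ?sx ?sy.
set b := side i x0; pose H b := map (ins i b) (cube n.+1).
have HE b' x : (x \in H b') = (x \in cube n.+2) && (side i x == b').
  by rewrite mem_half // mem_cube.
have uH b' : uniq (H b').
  rewrite map_inj_in_uniq ?uniq_cube // => x y; rewrite !mem_cube => /eqP sx /eqP sy.
  by move/(congr1 (del i)); rewrite !insK ?sx ?sy.
have pE : perm_eq (H b ++ H (~~ b)) (cube n.+2).
  apply: uniq_perm; [|exact: uniq_cube|].
    rewrite cat_uniq !uH andbT /=; apply/hasPn => x; rewrite !HE => /andP[-> /eqP->].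
    by case: (b).
  by move=> x; rewrite mem_cat !HE; case: (x \in _) => //=; case: (side i x) (b) => [] [].
have pE' := pE; rewrite perm_sym in pE'.
apply: (Sol_perm pE); apply: (Solv_split (U := [::]) (a := x0) adj_sym _ _ _ (sH b) (sH (~~ b))).
- by rewrite -/(H b) -/(H (~~ b)) (perm_uniq pE) uniq_cube.
- exact: (eq_invol pE').
- by move=> x xH; apply: pU; rewrite -(perm_mem pE).
- rewrite (eq_count (a2 := predT)) // count_predT size_map size_cube expnS oddM //.
- by rewrite -/(H b) HE x0c eqxx.
- by rewrite -/(H (~~ b)) HE px0 /=; move: si; rewrite -/b; case: (side i (p x0)) (b) => [] [].
Qed.

Lemma last_frag p z y : last z (frag p y) = p y.
Proof. by rewrite /frag; case: eqP => /=. Qed.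

Lemma tour_path p x s : {in s, forall y, p y = y \/ adj y (p y)} -> path (lk adj p) x s ->
  path adj (p x) (tour p s) /\ last (p x) (tour p s) = p (last x s).
Proof.
elim: s x => [|y s IHs] x //= ps /andP[xy ys]; rewrite tour_cons cat_path last_cat last_frag.
have [|-> ->] := IHs y _ ys; first by move=> z zs; apply: ps; rewrite inE zs orbT.
split=> //; rewrite andbT; move: xy (ps y (mem_head _ _)); rewrite /lk /frag.
by case: eqP => [_ /= ->|ne /= -> []] //= ->.
Qed.

Lemma tour_next p s y : uniq (tour p s) -> y \in s -> p y != y -> next (tour p s) y = p y.
Proof.
move=> us ys ne; case/splitPr: ys us => s1 s2.
rewrite tour_cat tour_cons {1 2}/frag (negbTE ne) => us.
by rewrite -(next_rot (size (tour p s1)) us) rot_size_cat /= eqxx.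
Qed.

Lemma Sol_cycle n p : invol p (cube n) -> real n p -> Sol adj (cube n) p ->
  exists c : seq vertex, [/\ perm_eq c (cube n), cycle adj c
    & {in cube n, forall x, p x = x \/ next c x = p x \/ next c (p x) = x}].
Proof.
move=> pI pr [s sA cs]; exists (tour p s).
have sub : {subset s <= cube n} by move=> x xs; rewrite -(perm_mem sA) entry_tour.
split=> //.
  case: s cs sub {sA} => // x s cs sub.
  rewrite (cycle_path x) in cs; have [|h1 h2] := tour_path _ cs; first by move=> y /sub/pr.
  by rewrite (cycle_path (p (last x (x :: s)))) h2.
move=> x xc; have : x \in tour p s by rewrite (perm_mem sA).
have [->|ne] := eqVneq (p x) x; first by left.
have us : uniq (tour p s) by rewrite (perm_uniq sA) uniq_cube.
rewrite mem_tour => /hasP[y ys /orP[]/eqP xE]; right.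
  by left; apply: tour_next => //; rewrite xE.
have [_ ppy] := pI _ (sub _ ys); right; rewrite xE ppy; apply: tour_next => //.
by move: ne; rewrite xE ppy eq_sym.
Qed.

(** Obtained from [fink] for the perfect matching in direction 0. For [m = 1] the cycle is the
    two-vertex list, which is all that chaining two layers requires. *)
Lemma gray m : 0 < m -> exists2 c : seq vertex, perm_eq c (cube m) & cycle adj c.
Proof.
case: m => // m _.
have fc x : x \in cube m.+1 -> adj x (flip 0 x).
  by rewrite mem_cube => /eqP sx; apply: adj_flip; rewrite sx.
have fI : invol (flip 0) (cube m.+1) by move=> x; rewrite !mem_cube size_flip flipK.
have [||c [cc cyc _]] := @Sol_cycle m.+1 (flip 0) fI; last by exists c.
  by move=> x /fc; right.
apply: (fink fI) => x /fc ax; rewrite in_nil; apply/negP => /eqP fx.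
by move: ax; rewrite fx adj_irr.
Qed.

Lemma adj_cat2l x y z : adj (x ++ y) (x ++ z) = adj y z.
Proof. by elim: x => //= b x ->; rewrite addbb. Qed.

Lemma adj_cat2r x y z : size x = size y -> adj (x ++ z) (y ++ z) = adj x y.
Proof.
elim: x y => [|b x IHx] [|b' y] //=; first by rewrite adj_irr.
by move=> [sxy]; rewrite IHx // eqseq_cat // eqxx andbT.
Qed.

Definition layer t := [seq a ++ t | a <- cube 5].

Lemma perm_layers m L : perm_eq L (cube m) -> perm_eq (flatten (map layer L)) (cube (5 + m)).
Proof.
move=> LE; have sub : {subset cube (5 + m) <= flatten (map layer L)}.
  move=> x; rewrite mem_cube => /eqP sx; apply/flatten_mapP; exists (drop 5 x).
    by rewrite (perm_mem LE) mem_cube size_drop sx addKn.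
  apply/mapP; exists (take 5 x); last by rewrite cat_take_drop.
  by rewrite mem_cube size_take sx; case: ifP => //; clear; lia.
have sz : size (flatten (map layer L)) <= size (cube (5 + m)).
  rewrite [size _](_ : _ = size (allpairs (fun t a => a ++ t) L (cube 5))) //.
  by rewrite size_allpairs (perm_size LE) !size_cube expnD mulnC.
have [_ eqm] := uniq_min_size (uniq_cube _) sub sz.
rewrite perm_sym; apply: uniq_perm eqm; first exact: uniq_cube.
exact: leq_size_uniq (uniq_cube _) sub sz.
Qed.

Section Layers.

Variables (m : nat) (p : vertex -> vertex).
Hypotheses (pI : invol p (cube (5 + m))) (pr : real (5 + m) p).
Hypothesis pd : {in cube (5 + m), forall x, drop 5 (p x) = drop 5 x}.
Hypothesis iF : {in fixpts (5 + m) p &, forall x y, drop 5 x = drop 5 y -> ~~ adj x y}.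

Definition lp t a := take 5 (p (a ++ t)).

Lemma cat_cube a t : a \in cube 5 -> t \in cube m -> a ++ t \in cube (5 + m).
Proof. by rewrite !mem_cube size_cat => /eqP-> /eqP->. Qed.

Lemma drop_cube a t : a \in cube 5 -> drop 5 (a ++ t) = t.
Proof. by rewrite mem_cube => /eqP sa; rewrite drop_size_cat. Qed.

Lemma lpE t a : a \in cube 5 -> t \in cube m -> p (a ++ t) = lp t a ++ t.
Proof.
move=> ac tc; have := pd (cat_cube ac tc); rewrite drop_cube // => dE.
by rewrite -[LHS](cat_take_drop 5) dE.
Qed.

Lemma lp_cube t a : a \in cube 5 -> t \in cube m -> lp t a \in cube 5.
Proof.
move=> ac tc; have [+ _] := pI (cat_cube ac tc); rewrite lpE // !mem_cube size_cat.
by move: tc; rewrite mem_cube => /eqP->; rewrite eqn_add2r.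
Qed.

Lemma lp_invol t : t \in cube m -> invol (lp t) (cube 5).
Proof.
move=> tc a ac; have lc := lp_cube ac tc; split=> //.
have [_] := pI (cat_cube ac tc); rewrite lpE // (lpE lc tc) => /eqP.
have sE : size (lp t (lp t a)) = size a.
  by move: ac (lp_cube lc tc); rewrite !mem_cube => /eqP-> /eqP->.
by rewrite eqseq_cat // => /andP[/eqP].
Qed.

Lemma lp_fix t a : a \in cube 5 -> t \in cube m -> (lp t a == a) = (p (a ++ t) == a ++ t).
Proof.
move=> ac tc; rewrite lpE // eqseq_cat ?eqxx ?andbT //.
by move: ac (lp_cube ac tc); rewrite !mem_cube => /eqP-> /eqP->.
Qed.

Lemma lp_real t : t \in cube m -> real 5 (lp t).
Proof.
move=> tc a ac; case: (pr (cat_cube ac tc)) => [/eqP|].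
  by rewrite -lp_fix // => /eqP; left.
rewrite lpE // adj_cat2r; first by right.
by move: ac (lp_cube ac tc); rewrite !mem_cube => /eqP-> /eqP->.
Qed.

Lemma lp_indep t : t \in cube m -> indep (fixpts 5 (lp t)).
Proof.
move=> tc a a'; rewrite !mem_filter => /andP[fa ac] /andP[fa' ac'].
rewrite -(adj_cat2r t); last by move: ac ac'; rewrite !mem_cube => /eqP-> /eqP->.
by apply: iF; rewrite ?mem_filter -?lp_fix ?fa ?fa' ?cat_cube ?drop_cube.
Qed.

Lemma lp_HP t a (b : vertex) : t \in cube m -> HP adj (cube 5) (lp t) a b ->
  HP adj (layer t) p (a ++ t) (b ++ t).
Proof.
move=> tc; apply: (@HP_iso _ _ adj adj (cat^~ t) (take 5)).
- by move=> x; rewrite mem_cube => /eqP sx; rewrite take_size_cat.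
- by move=> x xc; apply: lp_cube.
- by move=> x y; rewrite !mem_cube => /eqP sx /eqP sy; rewrite adj_cat2r // sx sy.
- by move=> x xc; rewrite /= lpE.
Qed.

(** A perfectly matched layer has a Hamilton cycle, which can be opened at any [a]; otherwise a free
    vertex of the parity opposite to [a] has a path to [a], which is reversed. *)
Lemma layer_HP t a : t \in cube m -> a \in cube 5 ->
  exists2 b : vertex, (b \in cube 5) /\ par b = ~~ par a & HP adj (layer t) p (a ++ t) (b ++ t).
Proof.
move=> tc ac; have lI := lp_invol tc.
case: (eqVneq (fixpts 5 (lp t)) [::]) => [F0|nF].
  have sol : Sol adj (cube 5) (lp t).
    apply: (fink lI) => x xc; rewrite in_nil; apply/negP => fx.
    have : x \in fixpts 5 (lp t) by rewrite mem_filter fx.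
    by rewrite F0.
  have [b hp ba] := Sol_HP adj_sym lI sol ac; exists b; last exact: lp_HP.
  split; first by move: ac; rewrite !mem_cube (adj_size ba).
  by rewrite adj_sym in ba; rewrite (adj_par ba).
have [u [uc pu _] hp] := five (~~ par a) lI (lp_real tc) (lp_indep tc) nF.
exists u => //; apply: lp_HP => //; apply: (HP_rev adj_sym lI); apply: hp => //.
by rewrite negbK.
Qed.

(** Crossing a layer changes the parity of the first five coordinates and stepping to the next layer
    keeps it; there are [size ts + 1] layers. *)
Lemma chain_HP t ts a : all (fun t => t \in cube m) (t :: ts) -> a \in cube 5 -> path adj t ts ->
  exists2 b : vertex, (b \in cube 5) /\ par b = par a (+) ~~ odd (size ts)
    & HP adj (flatten (map layer (t :: ts))) p (a ++ t) (b ++ last t ts).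
Proof.
elim: ts t a => [|t' ts IHts] t a; rewrite [all _ _]/= => /andP[tc tsc] ac.
  move=> _; have [b [bc pb] hp] := layer_HP tc ac; exists b; first by rewrite /= addbT.
  by have -> : flatten (map layer [:: t]) = layer t by exact: cats0.
rewrite [path _ _ _]/= => /andP[tt' pts]; have [b [bc pb] hp] := layer_HP tc ac.
have [c [cc pc] hp'] := IHts t' b tsc bc pts; exists c.
  by rewrite pc pb; split=> //=; case: (par a); case: (odd _).
by apply: (HP_cat hp hp'); rewrite adj_cat2l.
Qed.

(** The chain starts at [u] in the layer after that of [t0] and crosses the other [2 ^ m - 1]
    layers, an odd number, so it arrives over [t0] at a vertex of parity opposite to [u]. That
    vertex is not under control, but [u] has a Hamilton path to each such vertex. *)
Lemma Sol_layers : 0 < m -> Sol adj (cube (5 + m)) p.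
Proof.
move=> m0; case: (boolP (has (fun x => p x == x) (cube (5 + m)))); last first.
  move/hasPn => h; apply: (fink pI) => x xc; rewrite in_nil; exact: negbTE (h x xc).
case/hasP=> x xc fx; pose t0 := drop 5 x; pose a0 := take 5 x.
have sx : size x = 5 + m by apply/eqP; rewrite -mem_cube.
have t0c : t0 \in cube m by rewrite mem_cube size_drop sx addKn.
have a0c : a0 \in cube 5 by rewrite mem_cube size_take sx; case: ifP => //; clear; lia.
have nF : fixpts 5 (lp t0) != [::].
  have : a0 \in fixpts 5 (lp t0) by rewrite mem_filter a0c lp_fix // cat_take_drop fx.
  by case: (fixpts _ _).
have [u [uc pu _] hpu] := five false (lp_invol t0c) (lp_real t0c) (lp_indep t0c) nF.
have [c cE cyc] := gray m0.
have t0in : t0 \in c by rewrite (perm_mem cE).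
have [i c' rE] := rot_to t0in.
have {}cE : perm_eq (t0 :: c') (cube m) by rewrite -rE perm_rot.
have {}cyc : cycle adj (t0 :: c') by rewrite -rE rot_cycle.
have p2 : 2 ^ m = 2 * 2 ^ m.-1 by rewrite -expnS prednK.
have := perm_size cE; rewrite size_cube p2.
case: c' cE cyc {rE} => [|t1 ts] cE cyc sE.
  by exfalso; move: sE; rewrite /=; clear; lia.
have ev : ~~ odd (size ts) by move: sE; rewrite /=; clear; lia.
have tsc : all (fun t => t \in cube m) (t1 :: ts).
  by apply/allP => t tin; rewrite -(perm_mem cE) inE tin orbT.
move: cyc; rewrite /= rcons_path => /and3P[a01 pts alast].
have [b [bc pb] hp] := chain_HP tsc uc pts.
have pb' : par b = ~~ false by rewrite pb pu ev.
have hp0 := lp_HP t0c (HP_rev adj_sym (lp_invol t0c) (hpu b bc pb')).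
have hpa : HP adj (flatten (map layer (t1 :: ts)) ++ layer t0) p (u ++ t1) (u ++ t0).
  by apply: (HP_cat hp hp0); rewrite adj_cat2l.
have := HP_close hpa; rewrite adj_cat2l => /(_ a01); apply: Sol_perm.
have -> : flatten (map layer (t1 :: ts)) ++ layer t0 = flatten (map layer (rcons (t1 :: ts) t0)).
  by rewrite map_rcons flatten_rcons.
by apply: perm_layers; rewrite perm_rcons; exact: cE.
Qed.

End Layers.

Lemma Sol_low n p : 1 < n <= 5 -> invol p (cube n) -> real n p -> indep (fixpts n p) ->
  Sol adj (cube n) p.
Proof.
move=> nn pI pr iF.
have [F0|nF] := eqVneq (fixpts n p) [::].
  case: n nn pI pr iF F0 => // n _ pI pr iF F0; apply: (fink pI) => x xc.
  rewrite in_nil; apply/negP => fx.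
  have : x \in fixpts n.+1 p by rewrite mem_filter fx.
  by rewrite F0.
have uF : uniq (fixpts n p) by rewrite filter_uniq ?uniq_cube.
have FP x : (x \in fixpts n p) = (p x == x) && (x \in cube n) by rewrite mem_filter.
have sol : SolvI n -> count par (cube n) = count (predC par) (cube n) -> Sol adj (cube n) p.
  move=> sI cn; have bl := real_bal cn pI pr.
  have cf : conf n [::] (fixpts n p).
    by split=> // x; rewrite FP => /andP[].
  have := sI [::] (fixpts n p) cf isT bl; rewrite alive0; apply=> // x xc.
  by rewrite FP xc andbT.
case: n nn pI pr iF nF uF FP sol => [|[|[|[|[|[|n]]]]]] // _ pI pr iF nF uF FP sol.
(* In [Q_2] any two vertices of opposite parity are adjacent, so a balanced nonempty set of free
   vertices cannot be independent. *)
- have cn : count par (cube 2) = count (predC par) (cube 2) by vm_compute.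
  have := real_bal cn pI pr; rewrite /bal /= !addn0 => /eqP bl.
  have sF := count_predC par (fixpts 2 p).
  have c0 : 0 < size (fixpts 2 p) by case: (fixpts 2 p) nF.
  have /hasP[x xF px] : has par (fixpts 2 p).
    by rewrite has_count; move: bl sF c0; clear; lia.
  have /hasP[y yF py] : has (predC par) (fixpts 2 p).
    by rewrite has_count; move: bl sF c0; clear; lia.
  have := iF x y xF yF; move: xF yF px py; rewrite !FP !mem_cube => /andP[_ sx] /andP[_ sy].
  case: x y sx sy => [|x1 [|x2 [|? ?]]] // [|y1 [|y2 [|? ?]]] // _ _.
  by case: x1 x2 y1 y2 => [] [] [] [].
- by apply: sol; [exact: SolvI3|vm_compute].
- by apply: sol; [exact: SolvI4|vm_compute].
(* In dimension five itself, the Hamilton path from [u] is directed to a neighbour of [u] and closed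
   by that edge. *)
have [u [uc pu _] hp] := five false pI pr iF nF.
have su : size u = 5 by apply/eqP; rewrite -mem_cube.
have af : adj u (flip 0 u) by apply: adj_flip; rewrite su.
apply: (HP_close (hp (flip 0 u) _ _)); last by rewrite adj_sym.
  by rewrite mem_cube size_flip su.
by rewrite (adj_par af) pu.
Qed.

Lemma Sol_maximal n p : 1 < n -> invol p (cube n) -> real n p ->
    {in cube n, forall x, drop 5 (p x) = drop 5 x} ->
    {in fixpts n p &, forall x y, drop 5 x = drop 5 y -> ~~ adj x y} ->
  Sol adj (cube n) p.
Proof.
move=> n1 pI pr pd iF; case: (leqP n 5) => n5.
  apply: Sol_low => //; first by rewrite n1.
  move=> x y xF yF; apply: iF => //; move: xF yF.
  rewrite !mem_filter !mem_cube => /andP[_ /eqP sx] /andP[_ /eqP sy].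
  by rewrite !drop_oversize ?sx ?sy.
have nE : n = 5 + (n - 5) by rewrite subnKC // ltnW.
rewrite nE in pI pr pd iF *; apply: Sol_layers => //.
by rewrite subn_gt0.
Qed.

(** * Matchings of the hypercube *)

Section Hypercube.

Variable n : nat.
Hypothesis n1 : 1 < n.
Variable M : {set {set hypercube n}}.
Hypotheses (hM : matching (@hypercube_adj n) M) (hd : #|directions M| <= 5).

Lemma hadj_sym : symmetric (@hypercube_adj n).
Proof.
by move=> u v; congr (_ == 1); apply: eq_card => i; rewrite !inE eq_sym.
Qed.

Lemma hadj_irr (v : hypercube n) : hypercube_adj v v = false.
Proof.
rewrite /hypercube_adj (_ : differ v v = set0) ?cards0 //.
by apply/setP => i; rewrite !inE eqxx.
Qed.

Lemma matchingP E : E \in M -> exists u v : hypercube n, [/\ E = [set u; v], hypercube_adj u v & v != u].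
Proof.
case/andP: hM => /subsetP sM _ /sM/imsetP[[u v]]; rewrite inE /= => uv ->.
by exists u, v; split=> //; apply: contraTneq uv => ->; rewrite hadj_irr.
Qed.

Lemma matching_adj (v w : hypercube n) : [set v; w] \in M -> hypercube_adj v w.
Proof.
case/matchingP=> a [b [E ab ba]].
have aE : a \in [set v; w] by rewrite E set21.
have bE : b \in [set v; w] by rewrite E set22.
move: aE bE ab ba; rewrite !inE => /orP[]/eqP-> /orP[]/eqP-> //; rewrite ?eqxx //.
by rewrite hadj_sym.
Qed.

Lemma matching_same (v w w' : hypercube n) : [set v; w] \in M -> [set v; w'] \in M -> w' != v -> w' = w.
Proof.
case/andP: hM => _ /trivIsetP tM e1 e2 w'v.
case: (eqVneq [set v; w] [set v; w']) => [eE|/(tM _ _ e1 e2)].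
  by have := set22 v w'; rewrite -eE !inE (negbTE w'v) => /eqP.
by move/disjoint_setI0/setP/(_ v); rewrite !inE eqxx.
Qed.

Definition mate (v : hypercube n) :=
  if [pick w : hypercube n | (w != v) && ([set v; w] \in M)] is Some w then w else v.

Lemma mateP (v : hypercube n) : mate v = v \/ mate v != v /\ [set v; mate v] \in M.
Proof. by rewrite /mate; case: pickP => [w /andP[]|]; [right|left]. Qed.

Lemma mateE (v w : hypercube n) : [set v; w] \in M -> w != v -> mate v = w.
Proof.
move=> vw wv; rewrite /mate; case: pickP => [w' /andP[w'v vw']|/(_ w)].
  exact: (matching_same vw vw').
by rewrite wv vw.
Qed.

Lemma mateK : involutive mate.
Proof.
move=> v; case: (mateP v) => [E|[nv vM]]; first by rewrite !E.
by apply: mateE; rewrite 1?setUC // eq_sym.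
Qed.

(* Listing the directions of [M] first makes the edges of [M] move only the first
   five entries of [code]. *)
Definition coords : seq 'I_n := enum (directions M) ++ enum (~: directions M).

Lemma mem_coords (i : 'I_n) : i \in coords.
Proof. by rewrite mem_cat !mem_enum in_setC orbN. Qed.

Lemma uniq_coords : uniq coords.
Proof.
rewrite cat_uniq !enum_uniq andbT /=; apply/hasPn => i.
by rewrite !mem_enum in_setC.
Qed.

Lemma size_coords : size coords = n.
Proof. by rewrite size_cat -!cardE cardsC card_ord. Qed.

Definition code (v : hypercube n) : vertex := map v coords.
Definition decode (x : vertex) : hypercube n := [ffun i : 'I_n => nth false x (index i coords)].

Lemma codeK : cancel code decode.
Proof.
move=> v; apply/ffunP => i; rewrite ffunE (nth_map i) ?index_mem ?mem_coords //.
by rewrite nth_index ?mem_coords.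
Qed.

Lemma decodeK : {in cube n, cancel decode code}.
Proof.
move=> x; rewrite mem_cube => /eqP sx; have i0 : 'I_n by exact: (Ordinal n1).
apply: (eq_from_nth (x0 := false)); first by rewrite size_map size_coords sx.
move=> j; rewrite size_map => jn; rewrite (nth_map i0) // ffunE.
by rewrite index_uniq ?uniq_coords.
Qed.

Lemma code_cube (v : hypercube n) : code v \in cube n.
Proof. by rewrite mem_cube size_map size_coords. Qed.

Lemma adj_code (u v : hypercube n) : adj (code u) (code v) = hypercube_adj u v.
Proof.
rewrite adj_map -size_filter; congr (_ == 1); rewrite cardE.
apply/perm_size/uniq_perm; [exact: (filter_uniq _ uniq_coords)|exact: enum_uniq|move=> i].
by rewrite mem_filter mem_coords andbT mem_enum inE.
Qed.

Lemma drop_mate (v : hypercube n) : drop 5 (code (mate v)) = drop 5 (code v).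
Proof.
case: (mateP v) => [->//|[_ vM]]; rewrite /code -!map_drop; apply/eq_in_map => i.
have /cards1P[j dE] := matching_adj vM.
have jD : j \in directions M.
  by rewrite inE; apply/existsP; exists v; apply/existsP; exists (mate v); rewrite vM dE eqxx.
rewrite /coords drop_cat -cardE ltnNge hd /= => /mem_drop; rewrite mem_enum in_setC => iD.
apply/esym/eqP; rewrite -[_ == _]negbK; apply: contra iD => ne.
have : i \in differ v (mate v) by rewrite inE.
by rewrite dE inE => /eqP->.
Qed.

Lemma hamilton_ext : exists c : seq (hypercube n),
  hamilton_cycle (@hypercube_adj n) c /\ M \subset cycle_edges c.
Proof.
pose p x := code (mate (decode x)).
(* Adjacency within a layer: the edges of [M] satisfy it by [drop_mate], and the added edges are
   confined to layers as well. *)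
pose r x y := adj x y && (drop 5 x == drop 5 y).
have pI : invol p (cube n).
  by move=> x xc; rewrite /p code_cube codeK mateK decodeK.
have rs : symmetric r by move=> x y; rewrite /r adj_sym eq_sym.
have ri : irreflexive r by move=> x; rewrite /r adj_irr.
have pr : {in cube n, forall x, p x = x \/ r x (p x)}.
  have rm (v : hypercube n) : mate v = v \/ r (code v) (code (mate v)).
    case: (mateP v) => [|[_ /matching_adj vM]]; [by left|right].
    by rewrite /r adj_code vM drop_mate eqxx.
  move=> x xc; rewrite /p; case: (rm (decode x)) => [->|]; rewrite (decodeK xc); first by left.
  by right.
have [q [qI qr qp qF]] := maximal_ext rs ri pI pr.
have qre : real n q by move=> x /qr[->|/andP[]]; [left|right].
have qsol : Sol adj (cube n) q.
  apply: (Sol_maximal n1 qI qre) => [x /qr[->//|/andP[_ /eqP->//]]|x y xF yF dxy].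
  by have := qF x y xF yF; rewrite /r dxy eqxx andbT.
have [c [cE cyc nx]] := Sol_cycle qI qre qsol.
have cc x : x \in c -> x \in cube n by rewrite (perm_mem cE).
have cmE : c = map code (map decode c).
  by rewrite -map_comp -[LHS]map_id; apply/eq_in_map => x /cc xc /=; rewrite decodeK.
have uc : uniq (map decode c).
  by apply: (@map_uniq _ _ code); rewrite -cmE (perm_uniq cE) uniq_cube.
exists (map decode c); split.
  apply/and3P; split.
  - rewrite size_map (perm_size cE) size_cube.
    by apply: leq_trans (leq_pexp2l (isT : 0 < 2) n1).
  - apply/andP; split=> //.
    have eE : relpre code adj =2 @hypercube_adj n by move=> u v; rewrite /= adj_code.
    by rewrite -(eq_cycle eE) -cycle_map -cmE.
  apply/forallP => v; apply/mapP; exists (code v); last by rewrite codeK.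
  by rewrite (perm_mem cE) code_cube.
have nextE (v : hypercube n) : next c (code v) = code (next (map decode c) v).
  by rewrite {1}cmE (next_map (can_inj codeK)).
have memE (v : hypercube n) : v \in map decode c.
  by apply/mapP; exists (code v); rewrite ?codeK // (perm_mem cE) code_cube.
have inj := can_inj codeK.
apply/subsetP => E EM; have [u [v [EE _ vu]]] := matchingP EM.
have mu : mate u = v by apply: mateE => //; rewrite -EE.
have quv : q (code u) = code v.
  by rewrite qp ?code_cube // /p codeK mu // (inj_eq inj).
case: (nx (code u) (code_cube u)); rewrite quv.
  by move/inj => vu'; rewrite vu' eqxx in vu.
rewrite !nextE => -[/inj nu|/inj nv]; apply/imsetP.
  by exists u; rewrite ?nu ?EE.
by exists v; rewrite ?nv ?EE 1?setUC.
Qed.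

End Hypercube.

Theorem theorem4 (n : nat) (hn : 2 <= n) (M : {set {set hypercube n}})
    (hM : matching (@hypercube_adj n) M) (hd : #|directions M| <= 5) :
  exists c : seq (hypercube n),
    hamilton_cycle (@hypercube_adj n) c /\ M \subset cycle_edges c.
Proof. exact: hamilton_ext hn M hM hd. Qed.
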